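(* Let $n\ge1$, $\delta>0$ and $\beta<n+2$. Let $s\in\mathbb{R}$ and set $s'=s+\max\{0,\beta-n\}$. If $\mathbf b\in\mathcal H^s(\mathbf T^n)$ satisfies $\widehat{\mathbf b}_0=\mathbf 0$, then there is exactly one $\mathbf u\in\mathcal H^{s'}(\mathbf T^n)$ satisfying $\mathcal L^{\delta,\beta}\mathbf u=\mathbf b$ and $\widehat{\mathbf u}_0=\mathbf 0$.
   Context: Torus and spaces: $\mathbf T^n=\prod_{i=1}^n[0,2\pi]$ with periodic identification; a periodic vector distribution $\mathbf g$ is written $\mathbf g=\sum_{k\in\mathbb{Z}^n}\widehat{\mathbf g}_k e^{ik\cdot x}$ with Fourier coefficients $\widehat{\mathbf g}_k\in\mathbb{C}^n$. For $q\in\mathbb{R}$, $\mathcal H^q(\mathbf T^n)$ is the space of periodic vector distributions with $\|\mathbf g\|^2_{\mathcal H^q}=\sum_k(1+\|k\|^2)^q\|\widehat{\mathbf g}_k\|^2<\infty$. Multipliers: with ${}_pF_q(a_1,\dots,a_p;b_1,\dots,b_q;x)=\sum_{m\ge0}\frac{(a_1)_m\cdots(a_p)_m}{(b_1)_m\cdots(b_q)_m}\frac{x^m}{m!}$, where $(a)_m=a(a+1)\cdots(a+m-1)$, set for $\nu\in\mathbb{R}^n$ $$\lambda_1(\nu)=-\|\nu\|^2\Big(3\mu\,{}_3F_4\big(1,\tfrac52,\tfrac{n+2-\beta}{2};2,\tfrac32,\tfrac{n+4}{2},\tfrac{n+4-\beta}{2};-\tfrac14\|\nu\|^2\delta^2\big)+(\lambda^*-\mu)\,{}_1F_2\big(\tfrac{n+2-\beta}{2};\tfrac{n+2}{2},\tfrac{n+4-\beta}{2};-\tfrac14\|\nu\|^2\delta^2\big)^2\Big),$$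 $$\lambda_2(\nu)=-\mu\|\nu\|^2\,{}_2F_3\big(1,\tfrac{n+2-\beta}{2};2,\tfrac{n+4}{2},\tfrac{n+4-\beta}{2};-\tfrac14\|\nu\|^2\delta^2\big).$$ $M^{\delta,\beta}(\nu)$ is the real symmetric $n\times n$ matrix with $M^{\delta,\beta}(\nu)\nu=\lambda_1(\nu)\nu$ and $M^{\delta,\beta}(\nu)w=\lambda_2(\nu)w$ for $w\perp\nu$; $M^{\delta,\beta}(0)=0$. Write $M_k=M^{\delta,\beta}(k)$, $k\in\mathbb{Z}^n$. Operator: the linear state-based peridynamic operator $\mathcal L^{\delta,\beta}$ acts on periodic vector distributions by $\mathcal L^{\delta,\beta}\mathbf u=\sum_{k\in\mathbb{Z}^n}M_k\widehat{\mathbf u}_ke^{ik\cdot x}$. (On smooth fields it is $(n+2)\mu c^{\delta,\beta}\int_{B_\delta(0)}\frac{w\otimes w}{\|w\|^{\beta+2}}(\mathbf u(x+w)-\mathbf u(x))dw+(\lambda^*-\mu)\frac{(c^{\delta,\beta})^2}{4}\int_{B_\delta(0)}\int_{B_\delta(0)}\frac{w}{\|w\|^\beta}\otimes\frac{q}{\|q\|^\beta}\mathbf u(x+w+q)dq\,dw$ with $c^{\delta,\beta}=\frac{2(n+2-\beta)\Gamma(n/2+1)}{\pi^{n/2}\delta^{n+2-\beta}}$.) Standing assumption: the Lamé parameters satisfy $\mu>0$ and $\lambda^*\in\mathbb{R}$ is such that $\lambda_1(\nu)<0$ for all $\nu\ne0$ (and $\lambda_2(\nu)<0$ for all $\nu\neq0$).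 *)

(* Defs.v *)
From mathcomp Require Import all_boot all_order all_algebra.
From mathcomp Require Import all_classical all_reals all_analysis.
From mathcomp Require Import complex ring.

Set Implicit Arguments.
Unset Strict Implicit.
Unset Printing Implicit Defensive.

Import Order.TTheory GRing.Theory Num.Theory.
Import numFieldNormedType.Exports.
Import ComplexField.Normc.

Local Open Scope classical_set_scope.
Local Open Scope ring_scope.
Local Open Scope complex_scope.

Definition pochhammer (R : realType) (a : R) (m : nat) : R :=
  \prod_(i < m) (a + i%:R).

Definition pFq (R : realType) (a b : seq R) (x : R) : R :=
  limn (series (fun m : nat =>
    (\prod_(c <- a) pochhammer c m) / (\prod_(c <- b) pochhammer c m)
      * (x ^+ m / m`!%:R))).

(* The library norm on matrices is the sup norm, hence these. *)
Definition enormsq (R : realType) n (nu : 'cV[R]_n) : R :=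
  \sum_(i < n) (nu i 0) ^+ 2.

Definition cnormsq (R : realType) n (z : 'cV[R[i]]_n) : R :=
  \sum_(i < n) (normc (z i 0)) ^+ 2.

Definition lambda1 (R : realType) n (delta beta mu lams : R) (nu : 'cV[R]_n)
    : R :=
  let x := - (1 / 4) * enormsq nu * delta ^+ 2 in
  - enormsq nu *
    (3 * mu * pFq [:: 1; 5 / 2; (n%:R + 2 - beta) / 2]
                  [:: 2; 3 / 2; (n%:R + 4) / 2; (n%:R + 4 - beta) / 2] x
     + (lams - mu) * (pFq [:: (n%:R + 2 - beta) / 2]
                          [:: (n%:R + 2) / 2; (n%:R + 4 - beta) / 2] x) ^+ 2).

Definition lambda2 (R : realType) n (delta beta mu : R) (nu : 'cV[R]_n) : R :=
  let x := - (1 / 4) * enormsq nu * delta ^+ 2 in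
  - mu * enormsq nu *
    pFq [:: 1; (n%:R + 2 - beta) / 2]
        [:: 2; (n%:R + 4) / 2; (n%:R + 4 - beta) / 2] x.

(* For [nu = 0] both eigenvalues vanish and the second term has [_ / 0 = 0],
   so this is the zero matrix. [multiplierP] characterizes it by its action. *)
Definition multiplier (R : realType) n (delta beta mu lams : R)
    (nu : 'cV[R]_n) : 'M[R]_n :=
  (lambda2 delta beta mu nu)%:M
  + ((lambda1 delta beta mu lams nu - lambda2 delta beta mu nu) / enormsq nu)
      *: (nu *m nu^T).

Lemma enormsqE (R : realType) n (nu : 'cV[R]_n) :
  nu^T *m nu = (enormsq nu)%:M.
Proof.
apply/matrixP => i j; rewrite !mxE !ord1 /= mulr1n.
by apply: eq_bigr => k _; rewrite !mxE expr2.
Qed.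

Lemma enormsq_eq0 (R : realType) n (nu : 'cV[R]_n) :
  (enormsq nu == 0) = (nu == 0).
Proof.
apply/idP/eqP => [|->]; last first.
  by rewrite /enormsq big1 // => i _; rewrite mxE expr0n.
rewrite /enormsq psumr_eq0 => [/allP h|i _]; last exact: sqr_ge0.
apply/matrixP => i j; rewrite !ord1 mxE.
by have := h i (mem_index_enum _); rewrite /= sqrf_eq0 => /eqP.
Qed.

Lemma multiplier0 (R : realType) n (delta beta mu lams : R) :
  multiplier delta beta mu lams (0 : 'cV[R]_n) = 0.
Proof.
have e0 : enormsq (0 : 'cV[R]_n) = 0 by apply/eqP; rewrite enormsq_eq0.
by rewrite /multiplier /lambda2 e0 mulr0 !mul0r mul0mx scaler0 addr0 raddf0.
Qed.

Lemma multiplierP (R : realType) n (delta beta mu lams : R) (nu : 'cV[R]_n)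
    (M : 'M[R]_n) :
  M = multiplier delta beta mu lams nu <->
  [/\ M^T = M,
      M *m nu = lambda1 delta beta mu lams nu *: nu,
      forall w : 'cV[R]_n, w^T *m nu = 0 ->
        M *m w = lambda2 delta beta mu nu *: w
    & nu = 0 -> M = 0].
Proof.
set l1 := lambda1 _ _ _ _ _; set l2 := lambda2 _ _ _ _.
have sp : [/\ (multiplier delta beta mu lams nu)^T
              = multiplier delta beta mu lams nu,
      multiplier delta beta mu lams nu *m nu = l1 *: nu,
      forall w : 'cV[R]_n, w^T *m nu = 0 ->
        multiplier delta beta mu lams nu *m w = l2 *: w
    & nu = 0 -> multiplier delta beta mu lams nu = 0].
  split.
  - by rewrite /multiplier raddfD /= tr_scalar_mx linearZ /= trmx_mul trmxK.
  - have [nu0|nu0] := eqVneq nu 0; first by rewrite nu0 mulmx0 scaler0.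
    rewrite /multiplier -/l1 -/l2 mulmxDl mul_scalar_mx -scalemxAl -mulmxA.
    rewrite enormsqE mul_mx_scalar scalerA divfK ?enormsq_eq0 //.
    by rewrite -scalerDl addrC subrK.
  - move=> w wnu; rewrite /multiplier mulmxDl mul_scalar_mx -scalemxAl -mulmxA.
    have -> : nu^T *m w = 0 by rewrite -[LHS]trmxK trmx_mul trmxK wnu trmx0.
    by rewrite mulmx0 scaler0 addr0.
  - by move=> ->; exact: multiplier0.
split=> [->//|[_ M1 M2 M3]]; case: sp => _ S1 S2 S3.
have [nu0|nu0] := eqVneq nu 0; first by rewrite M3 // S3.
suff h (v : 'cV[R]_n) : M *m v = multiplier delta beta mu lams nu *m v.
  apply/matrixP => i j; have := h (delta_mx j 0); rewrite -!colE.
  by move=> /(congr1 (fun A : 'cV[R]_n => A i 0)); rewrite ![col _ _ _ _]mxE.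
pose c := (v^T *m nu) 0 0 / enormsq nu.
have cw : (v - c *: nu)^T *m nu = 0.
  rewrite linearB linearZ /= mulmxBl -scalemxAl enormsqE scale_scalar_mx.
  by rewrite /c divfK ?enormsq_eq0 // -mx11_scalar subrr.
have -> : v = c *: nu + (v - c *: nu) by rewrite addrC subrK.
by rewrite 2![_ *m (_ + (_ - _))]mulmxDr -!scalemxAr M1 S1 M2 // S2.
Qed.

Definition iter_pderiv (R : realType) n (w : seq 'I_n) (f : 'cV[R]_n -> R)
    : 'cV[R]_n -> R :=
  foldr (fun j (g : 'cV[R]_n -> R) => fun x => 'D_(delta_mx j 0) g x) f w.

Definition smooth (R : realType) n (f : 'cV[R]_n -> R) : Prop :=
  forall w : seq 'I_n,
    continuous (iter_pderiv w f)
    /\ forall (j : 'I_n) x, derivable (iter_pderiv w f) x (delta_mx j 0).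

Record testfun (R : realType) (n : nat) := TestFun {
  testfun_fun :> 'cV[R]_n -> R[i];
  testfun_periodic :
    forall j : 'I_n, periodic testfun_fun ((pi *+ 2) *: delta_mx j 0);
  testfun_smooth_Re : smooth (fun x => complex.Re (testfun_fun x));
  testfun_smooth_Im : smooth (fun x => complex.Im (testfun_fun x)) }.

(* A continuous linear map from the smooth periodic functions, with the usual
   Frechet topology, to C^n. *)
Record pvdist (R : realType) (n : nat) := PVDist {
  pvdist_fun :> testfun R n -> 'cV[R[i]]_n;
  pvdist_linear : forall (a : R[i]) (phi psi chi : testfun R n),
    (forall x, chi x = a * phi x + psi x) ->
    pvdist_fun chi = a *: pvdist_fun phi + pvdist_fun psi;
  pvdist_continuous : exists (N : nat) (C : R),
    forall (phi : testfun R n) (B : R),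
      (forall (w : seq 'I_n) x, (size w <= N)%N ->
         `|iter_pderiv w (fun y => complex.Re (phi y)) x| <= B
         /\ `|iter_pderiv w (fun y => complex.Im (phi y)) x| <= B) ->
      forall j : 'I_n, normc (pvdist_fun phi j 0) <= C * B }.

Definition phase (R : realType) n (k : 'cV[int]_n) (x : 'cV[R]_n) : R :=
  \sum_(j < n) (k j 0)%:~R * x j 0.

Lemma phaseD (R : realType) n (k : 'cV[int]_n) (x y : 'cV[R]_n) :
  phase k (x + y) = phase k x + phase k y.
Proof.
by rewrite /phase -big_split; apply: eq_bigr => j _; rewrite mxE mulrDr.
Qed.

Lemma phaseZ (R : realType) n (k : 'cV[int]_n) (c : R) (x : 'cV[R]_n) :
  phase k (c *: x) = c * phase k x.
Proof.
by rewrite /phase mulr_sumr; apply: eq_bigr => j _; rewrite mxE mulrCA.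
Qed.

Lemma phase_delta (R : realType) n (k : 'cV[int]_n) (j : 'I_n) :
  phase k (delta_mx j 0 : 'cV[R]_n) = (k j 0)%:~R.
Proof.
rewrite /phase (bigD1 j) //= big1 ?addr0 => [|l /negbTE lj].
  by rewrite mxE !eqxx mulr1.
by rewrite mxE lj mulr0.
Qed.

Lemma phase_continuous (R : realType) n (k : 'cV[int]_n) :
  continuous (@phase R n k).
Proof.
have -> : @phase R n k =
    \sum_(j < n) (fun x : 'cV[R]_n => (k j 0)%:~R * x j 0).
  by apply/funext => x; rewrite /phase fct_sumE.
elim/big_ind: _ => [|f g cf cg|j _] x.
- by apply: cst_continuous.
- exact: (cvgD (cf x) (cg x)).
- exact: (cvgM (cvg_cst _) (@coord_continuous R n 1 j 0 x)).
Qed.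

Lemma cosD2piz (R : realType) (x : R) (m : int) :
  cos (x + m%:~R * (pi *+ 2)) = cos x.
Proof.
case: m => m; first by rewrite mulr_natl (periodicn (@cosD2pi R)).
rewrite NegzE mulrNz mulNr -[LHS](periodicn (@cosD2pi R) m.+1).
by rewrite mulr_natl subrK.
Qed.

Lemma sinD2piz (R : realType) (x : R) (m : int) :
  sin (x + m%:~R * (pi *+ 2)) = sin x.
Proof.
case: m => m; first by rewrite mulr_natl (periodicn (@sinD2pi R)).
rewrite NegzE mulrNz mulNr -[LHS](periodicn (@sinD2pi R) m.+1).
by rewrite mulr_natl subrK.
Qed.

Lemma is_derive_line (R : realType) n (f : 'cV[R]_n -> R) (x v : 'cV[R]_n)
    (d : R) :
  is_derive (0 : R) (1 : R) (fun h : R => f (h *: v + x)) d -> is_derive x v f d.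
Proof.
move=> [df Df]; split; first exact/derivable1P.
rewrite -Df /derive; set g1 := fun h => h^-1 *: _; set g2 := fun h => h^-1 *: _.
suff -> : g1 = g2 by [].
apply/funext => h; rewrite /g1 /g2 /=.
by rewrite addr0 scale0r add0r [h *: 1]mulr1.
Qed.

Definition trig (R : realType) n (k : 'cV[int]_n) (a b : R) (x : 'cV[R]_n) :=
  a * cos (phase k x) + b * sin (phase k x).

Lemma is_derive_trig (R : realType) n (k : 'cV[int]_n) (a b : R) j
    (x : 'cV[R]_n) :
  is_derive x (delta_mx j 0) (trig k a b)
    (trig k ((k j 0)%:~R * b) (- (k j 0)%:~R * a) x).
Proof.
apply: is_derive_line; set c : R := (k j 0)%:~R.
have -> : (fun h : R => trig k a b (h *: delta_mx j 0 + x)) =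
  (fun h : R => a * cos (c * h + phase k x) + b * sin (c * h + phase k x)).
  by apply/funext => h; rewrite /trig phaseD phaseZ phase_delta [h * _]mulrC.
apply: is_derive_eq; rewrite /trig mulr0 add0r /GRing.scale /=; ring.
Qed.

Lemma iter_pderiv_trig (R : realType) n (k : 'cV[int]_n) (w : seq 'I_n)
    (a b : R) : exists a' b', iter_pderiv w (trig k a b) = trig k a' b'.
Proof.
elim: w => [|j w [a' [b' IH]]] /=; first by exists a, b.
exists ((k j 0)%:~R * b'), (- (k j 0)%:~R * a').
by apply/funext => x; rewrite IH; have [_ ->] := is_derive_trig k a' b' j x.
Qed.

Lemma smooth_trig (R : realType) n (k : 'cV[int]_n) (a b : R) :
  smooth (trig k a b).
Proof.
move=> w; have [a' [b' ->]] := iter_pderiv_trig k w a b; split=> [x|j x].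
  have hp := @phase_continuous R n k x.
  have hc := continuous_comp hp (@continuous_cos R (phase k x)).
  have hs := continuous_comp hp (@continuous_sin R (phase k x)).
  exact: (cvgD (cvgM (cvg_cst _) hc) (cvgM (cvg_cst _) hs)).
by have [] := is_derive_trig k a' b' j x.
Qed.

Definition expik_fun (R : realType) n (k : 'cV[int]_n) (x : 'cV[R]_n) : R[i] :=
  cos (phase k x) +i* sin (phase k x).

Lemma expik_periodic (R : realType) n (k : 'cV[int]_n) (j : 'I_n) :
  periodic (@expik_fun R n k) ((pi *+ 2) *: delta_mx j 0).
Proof.
move=> x; rewrite /expik_fun phaseD phaseZ phase_delta mulrC.
by rewrite cosD2piz sinD2piz.
Qed.

Lemma expik_smooth_Re (R : realType) n (k : 'cV[int]_n) :
  smooth (fun x : 'cV[R]_n => complex.Re (expik_fun k x)).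
Proof.
have <- : trig k 1 0 = (fun x : 'cV[R]_n => complex.Re (expik_fun k x)).
  by apply/funext => x; rewrite /trig mul1r mul0r addr0.
exact: smooth_trig.
Qed.

Lemma expik_smooth_Im (R : realType) n (k : 'cV[int]_n) :
  smooth (fun x : 'cV[R]_n => complex.Im (expik_fun k x)).
Proof.
have <- : trig k 0 1 = (fun x : 'cV[R]_n => complex.Im (expik_fun k x)).
  by apply/funext => x; rewrite /trig mul1r mul0r add0r.
exact: smooth_trig.
Qed.

Definition expik (R : realType) n (k : 'cV[int]_n) : testfun R n :=
  TestFun (@expik_periodic R n k) (@expik_smooth_Re R n k)
    (@expik_smooth_Im R n k).

(* A periodic integrable [f] acts by [phi |-> \int f phi] over the torus. *)
Definition fcoef (R : realType) n (g : pvdist R n) (k : 'cV[int]_n)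
    : 'cV[R[i]]_n :=
  (((pi *+ 2) ^+ n)^-1)%:C *: g (expik R (- k)).

Definition in_sobolev (R : realType) n (q : R) (g : pvdist R n) : Prop :=
  (\esum_(k in [set: 'cV[int]_n])
     ((1 + enormsq (map_mx intr k : 'cV[R]_n)) `^ q * cnormsq (fcoef g k))%:E
   < +oo)%E.

(* [v = L u], i.e. [v] is the sum of [M_k u_k exp(i k.x)]: a periodic
   distribution is the sum of its Fourier series, and equals a given Fourier
   series iff its coefficients are the prescribed ones. *)
Definition is_peridynamic (R : realType) n (delta beta mu lams : R)
    (u v : pvdist R n) : Prop :=
  forall k : 'cV[int]_n,
    fcoef v k =
      map_mx (real_complex R)
        (multiplier delta beta mu lams (map_mx intr k : 'cV[R]_n))
      *m fcoef u k.

(* Main.v *)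
Require Import Defs.
From mathcomp Require Import all_boot all_order all_algebra.
From mathcomp Require Import all_classical all_reals all_analysis.
From mathcomp Require Import complex ring lra zify.

(** The operator is diagonal in Fourier variables, so the solution must have the
    coefficients [M_k^-1 b_k] for [k != 0] and [0] at [k = 0]. Two facts make
    this an existence and uniqueness theorem in the right Sobolev space.

    First, both eigenvalues of [M_k] are at most
    [- kap * (1 + |k|^2)^(max 0 (beta - n) / 2)] for [k != 0] ([lambda_lower]).
    Write [x = (|k| delta / 2)^2], [a = (n + 2 - beta) / 2], [c = (n + 2) / 2].
    The hypergeometric functions are averages of Bessel functions over the radius
    of the ball, hence solve first order equations [x f' + p f = rhs] with a
    Bessel function on the right. The Bessel functions are controlled by energy
    estimates ([bes_le1], [bes_decay]), and the equations are solved up to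
    constants by comparison with powers ([euler_comparison]). The transverse
    eigenvalue is of order at least [x^(max 0 (1 - a))] ([trans_sym_lower]),
    so is the part of the longitudinal one with the factor [mu]
    ([long_part_lower]), and the squared part is of lower order whatever the sign
    of its coefficient ([dil_sym_bound]). Bounded frequencies are covered by the
    sign hypotheses and compactness ([positive_lower]).

    Second, periodic distributions, which are continuous functionals on smooth
    periodic functions, are determined by their Fourier coefficients
    ([pvdist_eq]), and every family of polynomial growth is the family of
    coefficients of a distribution ([pvdist_of_coef]). Both are obtained without
    integration, from the finite Fourier transform on the grid of
    [(2 K + 1)^n] points. It is exactly invertible ([dft_inversion]), and the
    transforms of a smooth function decay rapidly, uniformly in [K], because the
    transform turns difference quotients into multiplication ([dft_decay]). Limits
    as [K] grows are taken along an ultrafilter: they always exist for bounded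
    sequences, are linear, and preserve the uniform bounds. For the existence of
    distributions, the sums of the prescribed coefficients against
    the finite transforms are bounded by a seminorm of the test function. For
    uniqueness, the limits of the finite transforms are coefficients whose Fourier
    sums approximate a test function in every seminorm ([fourier_tail],
    [fourier_rem_seminorm]).

    The bound on the eigenvalues then compares the Sobolev norms of [M_k^-1 b_k] and
    [b_k] term by term. *)

Set Implicit Arguments.
Unset Strict Implicit.
Unset Printing Implicit Defensive.

Import Order.TTheory GRing.Theory Num.Theory.
Import numFieldNormedType.Exports.
Import ComplexField.Normc.

Local Open Scope classical_set_scope.
Local Open Scope ring_scope.
Local Open Scope complex_scope.

(** * Entire power series *)

Section Entire.
Variable R : realType.
Implicit Types (u v : nat -> R) (x : R).

(** The coefficient sequences of everywhere convergent power series, in the form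
    of Cauchy's estimates, which is stable under differentiation. *)
Definition entire u :=
  forall r, 0 <= r -> exists C, forall m, `|u m| * r ^+ m <= C.

Definition psum u x : R := limn (pseries u x).

Lemma entire_fact C u : (forall m, `|u m| <= C / m`!%:R) -> entire u.
Proof.
move=> uC r r0; exists (C * expR r) => m.
have C0 : 0 <= C.
  by have := le_trans (normr_ge0 _) (uC 0%N); rewrite fact0 divr1.
apply: le_trans (ler_wpM2r (exprn_ge0 _ r0) (uC m)) _.
rewrite -mulrA; apply: ler_wpM2l => //; rewrite mulrC.
case: m => [|m]; first by rewrite expr0 fact0 divr1 -expR0 ler_expR.
by apply: le_trans (expR_ge1Dxn m r0); rewrite lerDr.
Qed.

Lemma entire_natM u : entire u -> entire (fun m => m%:R * u m).
Proof.
move=> eu r r0; have [C uC] := eu (2 * r) (mulr_ge0 (ler0n _ 2) r0).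
exists C => m; apply: le_trans (uC m); rewrite normrM ger0_norm // exprMn.
rewrite -mulrA [m%:R * _]mulrCA; apply: ler_wpM2l => //.
apply: ler_wpM2r; first exact: exprn_ge0.
by rewrite -natrX ler_nat ltnW // ltn_expl.
Qed.

Lemma entire_shift u : entire u -> entire (fun m => u m.+1).
Proof.
move=> eu r r0; have [C uC] := eu (r + 1) (addr_ge0 r0 ler01).
exists C => m; apply: le_trans (uC m.+1); apply: ler_wpM2l => //.
apply: (@le_trans _ _ ((r + 1) ^+ m)).
  by rewrite lerXn2r ?nnegrE ?addr_ge0 // lerDl.
by rewrite exprS ler_peMl ?exprn_ge0 ?addr_ge0 // lerDr.
Qed.

Lemma entire_diffs u : entire u -> entire (pseries_diffs u).
Proof. by move=> /entire_natM/entire_shift. Qed.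

Lemma entireD (p q : R) u v :
  entire u -> entire v -> entire (fun m => p * u m + q * v m).
Proof.
move=> eu ev r r0; have [C uC] := eu r r0; have [D vD] := ev r r0.
exists (`|p| * C + `|q| * D) => m.
apply: (@le_trans _ _ ((`|p| * `|u m| + `|q| * `|v m|) * r ^+ m)).
  by rewrite ler_wpM2r ?exprn_ge0 // -!normrM ler_normD.
by rewrite mulrDl -!mulrA lerD // ler_wpM2l.
Qed.

Lemma entire_cvg u x : entire u -> cvgn (pseries u x).
Proof.
move=> eu; have [C uC] := eu (2 * `|x|) (mulr_ge0 (ler0n _ 2) (normr_ge0 _)).
have C0 : 0 <= C.
  by have := uC 0%N; rewrite expr0 mulr1; apply: le_trans.
apply: normed_cvg; rewrite /normed_series_of /=.
apply: (@series_le_cvg _ _ (geometric C 2^-1)) => [//|m|m|].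
- by rewrite /= mulr_ge0 // exprn_ge0.
- rewrite normrM normrX /= exprVn ler_pdivlMr ?exprn_gt0 //.
  by rewrite -mulrA -exprMn mulrC [`|x| * _]mulrC mulrC.
- by apply: is_cvg_geometric_series; rewrite ger0_norm // invf_lt1 // ltr1n.
Qed.

Lemma is_derive_psum u x :
  entire u -> is_derive x 1 (psum u) (psum (pseries_diffs u) x).
Proof.
move=> eu; apply: (@pseries_snd_diffs _ _ (`|x| + 1)).
- exact: entire_cvg.
- exact/entire_cvg/entire_diffs.
- exact/entire_cvg/entire_diffs/entire_diffs.
by rewrite [ltRHS]ger0_norm ?addr_ge0// ltrDl.
Qed.

Lemma psumD (p q : R) u v x : entire u -> entire v ->
  psum (fun m => p * u m + q * v m) x = p * psum u x + q * psum v x.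
Proof.
move=> eu ev; rewrite /psum /pseries.
have -> : (fun m => (p * u m + q * v m) * x ^+ m) =
   p *: (fun m => u m * x ^+ m) + q *: (fun m => v m * x ^+ m).
  by apply/funext => m; rewrite mulrDl -!mulrA.
have cu := entire_cvg (x := x) eu; have cv := entire_cvg (x := x) ev.
rewrite lim_seriesD; try exact: is_cvg_seriesZ.
by rewrite !lim_seriesZ.
Qed.

Lemma psumZ (p : R) u x : entire u -> psum (fun m => p * u m) x = p * psum u x.
Proof.
move=> eu; rewrite -[RHS]addr0 -[in RHS](mul0r (psum u x)) -psumD //.
by congr (psum _ x); apply/funext => m; rewrite mul0r addr0.
Qed.

Lemma psum_eq0 u x : (forall m, u m = 0) -> psum u x = 0.
Proof.
move=> u0; apply: cvg_lim => //; rewrite (_ : pseries u x = cst 0).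
  exact: cvg_cst.
by apply/funext => m; rewrite /pseries /series /= big1 // => i _; rewrite u0 mul0r.
Qed.

Lemma psum_shift u x : entire u ->
  psum u x = u 0%N + x * psum (fun m => u m.+1) x.
Proof.
move=> eu; have h := entire_cvg (x := x) (entire_shift eu).
apply: cvg_lim => //; rewrite -cvg_shiftS.
rewrite (_ : (fun n => _) = cst (u 0%N) + series (x *: (fun m => u m.+1 * x ^+ m))).
  apply: cvgD; first exact: cvg_cst.
  rewrite -[X in _ --> X]/(x *: limn _) -lim_seriesZ //.
  exact: is_cvg_seriesZ.
apply/funext => m; rewrite /pseries /series /= big_nat_recl // expr0 mulr1.
by congr (_ + _); apply: eq_bigr => i _; rewrite exprS mulrCA.
Qed.

Lemma psum_xderiv u x : entire u ->
  x * psum (pseries_diffs u) x = psum (fun m => m%:R * u m) x.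
Proof.
by move=> eu; rewrite [RHS]psum_shift ?mul0r ?add0r //; exact: entire_natM.
Qed.

End Entire.

(** * Comparison for Euler-type differential inequalities *)

Section Monotone.
Variable R : realType.
Implicit Types (f df : R -> R) (p x : R).

Lemma ge0_derive_ndecr f df x0 :
  (forall x, x0 <= x -> is_derive x 1 f (df x)) ->
  (forall x, x0 <= x -> 0 <= df x) ->
  forall x, x0 <= x -> f x0 <= f x.
Proof.
move=> fdf df0 x x0x.
have [c|c|c ci e] := @MVT_segment R f df x0 x x0x.
- by rewrite in_itv /= => /andP[/ltW c0 _]; exact: fdf.
- apply: derivable_within_continuous => y; rewrite in_itv /= => /andP[y0 _].
  by have [] := fdf y y0.
- rewrite -subr_ge0 e mulr_ge0 ?subr_ge0 // df0 //.
  by move: ci; rewrite in_itv /= => /andP[].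
Qed.

(** Multiplying by the integrating factor [x `^ p] turns the hypothesis into
    monotonicity of [x `^ p * f x]. All the asymptotics below are read off the
    Euler-type equations [x f' + p f = rhs] by comparing [f] with explicit
    solutions built from powers. *)
Lemma euler_comparison p f x0 : 0 < x0 ->
  (forall x, x0 <= x ->
     exists2 d, is_derive x 1 f d & 0 <= x * d + p * f x) ->
  0 <= f x0 -> forall x, x0 <= x -> 0 <= f x.
Proof.
move=> x00 h f0 x x0x; have xgt0 y : x0 <= y -> 0 < y by exact: lt_le_trans.
have df y : x0 <= y -> is_derive y 1 f ('D_1 f y).
  by move=> /h[d [dd dE] _]; split.
have dfE y : x0 <= y -> 0 <= y * 'D_1 f y + p * f y.
  by move=> /h[d [_ ->]].
have : x0 `^ p * f x0 <= x `^ p * f x.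
  apply: (@ge0_derive_ndecr (fun y => y `^ p * f y)
    (fun y => y `^ (p - 1) * (y * 'D_1 f y + p * f y))) => // y x0y; last first.
    by rewrite mulr_ge0 ?powR_ge0 ?dfE.
  have y0 := xgt0 _ x0y; have dp := is_derive1_powR p y0.
  have df' := df _ x0y; apply: is_derive_eq; rewrite /GRing.scale /=.
  have -> : y `^ p = y `^ (p - 1) * y.
    by rewrite -{3}[y]powRr1 ?(ltW y0) // -powRD ?subrK // (gt_eqF y0) implybT.
  ring.
move=> hp; rewrite -(pmulr_rge0 _ (powR_gt0 p (xgt0 _ x0x))).
by apply: le_trans hp; rewrite mulr_ge0 ?powR_ge0.
Qed.

(** Powers solve the homogeneous Euler equation, so they can be added freely to
    the functions that are compared. *)
Lemma is_derive_powR_euler p x : 0 < x ->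
  exists2 d : R, is_derive x 1 (fun y => y `^ p) d & x * d = p * x `^ p.
Proof.
move=> x0; exists (p * x `^ (p - 1)); first exact: is_derive1_powR.
rewrite mulrCA; congr (_ * _); rewrite mulrC.
by rewrite -{2}[x]powRr1 ?(ltW x0) // -powRD ?subrK // (gt_eqF x0) implybT.
Qed.

Lemma is_derive_inv (y : R) : y != 0 ->
  is_derive y 1 (fun z : R => z^-1) (- y ^- 2).
Proof.
move=> y0; have h := @is_deriveV R id y 1 1 y0 (is_derive_id y 1).
apply: (@is_derive_eq _ _ _ _ _ _ _ _ h); exact: mulr1.
Qed.

Lemma powR_small p e : 0 < p -> 0 < e -> exists2 X : R, 1 <= X &
  forall x, X <= x -> x `^ (- p) <= e.
Proof.
move=> p0 e0; exists (Num.max 1 (e^-1 `^ p^-1)); first by rewrite le_max lexx.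
move=> x; rewrite ge_max => /andP[x1 xe].
have x0 : 0 < x by exact: lt_le_trans x1.
rewrite powRN -[leRHS]invrK lef_pV2 ?posrE ?invr_gt0 ?powR_gt0 //.
have -> : e^-1 = (e^-1 `^ p^-1) `^ p.
  by rewrite -powRrM mulVf ?gt_eqF // powRr1 // invr_ge0 ltW.
by rewrite ge0_ler_powR ?nnegrE ?powR_ge0 ?(ltW p0) ?(ltW x0).
Qed.

End Monotone.

(** * Normalised Bessel functions *)

Section Bessel.
Variable R : realType.
Implicit Types (a c x : R) (m : nat).

Lemma pochhammerSl c m : pochhammer c m.+1 = c * pochhammer (c + 1) m.
Proof.
rewrite /pochhammer big_ord_recl addr0; congr (_ * _).
by apply: eq_bigr => i _; rewrite -addrA nat1r.
Qed.

Lemma pochhammerSr c m : pochhammer c m.+1 = pochhammer c m * (c + m%:R).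
Proof. by rewrite /pochhammer big_ord_recr. Qed.

Lemma pochhammer_gt0 c m : 0 < c -> 0 < pochhammer c m.
Proof. by move=> c0; apply: prodr_gt0 => i _; rewrite ltr_wpDr. Qed.

Lemma pochhammer_ge c m : 0 < c -> (pochhammer c m)^-1 <= 1 + c^-1.
Proof.
move=> c0; case: m => [|m].
  by rewrite /pochhammer big_ord0 invr1 lerDl invr_ge0 ltW.
rewrite pochhammerSl invfM (@le_trans _ _ (c^-1)) ?lerDr //.
rewrite ler_piMr ?invr_ge0 ?(ltW c0) // invf_le1 ?pochhammer_gt0 ?addr_gt0 //.
rewrite /pochhammer; elim/big_ind: _ => // [y z|i _]; first exact: mulr_ege1.
by rewrite -addrA addrCA lerDl addr_ge0 // ltW.
Qed.

Definition besc c m : R := (-1) ^+ m / (pochhammer c m * m`!%:R).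

(** The two-term recurrence of the coefficients, which is Bessel's equation read
    on power series. *)
Lemma bescS c m : 0 < c ->
  besc c m.+1 * ((c + m%:R) * m.+1%:R) = - besc c m.
Proof.
move=> c0; rewrite /besc pochhammerSr factS natrM exprS.
have h1 := lt0r_neq0 (pochhammer_gt0 m c0).
have h2 : m`!%:R != 0 :> R by rewrite pnatr_eq0 -lt0n fact_gt0.
have h3 : m.+1%:R != 0 :> R by rewrite pnatr_eq0.
have h4 : c + m%:R != 0 by rewrite lt0r_neq0 // ltr_wpDr.
by field; rewrite h1 h2 h4 nat1r h3.
Qed.

Lemma besc_succ c m : 0 < c ->
  besc (c + 1) m = - c * (besc c m.+1 * m.+1%:R).
Proof.
move=> c0; rewrite /besc pochhammerSl factS natrM exprS.
have h1 := lt0r_neq0 (pochhammer_gt0 m (addr_gt0 c0 ltr01)).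
have h2 : m`!%:R != 0 :> R by rewrite pnatr_eq0 -lt0n fact_gt0.
have h3 : m.+1%:R != 0 :> R by rewrite pnatr_eq0.
have h4 := lt0r_neq0 c0.
by field; rewrite h1 h2 h4 nat1r h3.
Qed.

Lemma entire_besc (w : nat -> R) C c : 0 < c -> (forall m, `|w m| <= C) ->
  entire (fun m => w m * besc c m).
Proof.
move=> c0 wC; apply: (@entire_fact _ (C * (1 + c^-1))) => m.
rewrite normrM -mulrA; apply: ler_pM => //.
rewrite /besc normrM normrX normrN1 expr1n mul1r normfV normrM invfM.
rewrite (gtr0_norm (pochhammer_gt0 m c0)) ger0_norm //.
by rewrite ler_wpM2r ?invr_ge0 // pochhammer_ge.
Qed.

Lemma entire_besc1 c : 0 < c -> entire (besc c).
Proof.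
move=> c0; have -> : besc c = (fun m => 1 * besc c m).
  by apply/funext => m; rewrite mul1r.
by apply: (@entire_besc (fun=> 1) 1) => // m; rewrite normr1.
Qed.

(** [bes c] is the hypergeometric function 0F1(; c; -x), that is, the Bessel
    function of order [c - 1] at [2 * sqrt x], divided by its leading power. *)
Definition bes c : R -> R := psum (besc c).

Definition dbes c : R -> R := psum (pseries_diffs (besc c)).

Lemma bes0 c : 0 < c -> bes c 0 = 1.
Proof.
move=> c0; rewrite /bes psum_shift ?mul0r ?addr0; last exact: entire_besc1.
by rewrite /besc /pochhammer big_ord0 mul1r fact0 expr0 divr1.
Qed.

Lemma is_derive_bes c x : 0 < c -> is_derive x 1 (bes c) (dbes c x).
Proof. by move=> c0; apply/is_derive_psum/entire_besc1. Qed.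

Lemma dbesE c x : 0 < c -> bes (c + 1) x = - c * dbes c x.
Proof.
move=> c0; have e := entire_diffs (entire_besc1 c0).
rewrite -psumZ //; congr (psum _ x); apply/funext => m.
by rewrite besc_succ // /pseries_diffs [besc _ _ * _]mulrC.
Qed.

(** Bessel's equation [x g'' + c g' + g = 0]. The second derivative is only needed
    to differentiate energies, where the equation eliminates it. *)
Lemma bes_ode c x : 0 < c -> exists2 d,
  is_derive x 1 (dbes c) d & x * d + c * dbes c x + bes c x = 0.
Proof.
move=> c0; have e0 := entire_besc1 c0; have e1 := entire_diffs e0.
exists (psum (pseries_diffs (pseries_diffs (besc c))) x).
  exact: is_derive_psum.
have e2 := entire_natM e1.
rewrite psum_xderiv // -[psum (fun m => _) x]mul1r -psumD //.
rewrite -[psum (fun m => _) x]mul1r -[bes c x]mul1r -psumD //; last exact: entireD.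
apply: psum_eq0 => m.
rewrite !mul1r -[besc c m]opprK -bescS // /pseries_diffs; ring.
Qed.

(** [bes c ^+ 2 + x * dbes c ^+ 2] is the energy of Bessel's equation; it starts
    at [1] and the damping term makes it decrease. *)
Lemma bes_le1 c x : 2^-1 <= c -> 0 <= x -> bes c x ^+ 2 <= 1.
Proof.
move=> c2 x0; have c0 : 0 < c by apply: lt_le_trans c2; rewrite invr_gt0.
pose E y := - (bes c y ^+ 2 + y * dbes c y ^+ 2).
pose dE y := (2 * c - 1) * dbes c y ^+ 2.
(* the sign makes the energy nondecreasing, as the monotonicity lemma expects *)
suff : E 0 <= E x.
  rewrite /E mul0r addr0 bes0 // expr1n.
  by have := mulr_ge0 x0 (sqr_ge0 (dbes c x)); lra.
apply: (@ge0_derive_ndecr R E dE) => // y y0; last first.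
  by rewrite mulr_ge0 ?sqr_ge0 //; lra.
have d1 := is_derive_bes y c0; have [d d2 ode] := bes_ode y c0.
apply: is_derive_eq; rewrite /GRing.scale /= /dE.
transitivity ((2 * c - 1) * dbes c y ^+ 2
  - 2 * dbes c y * (y * d + c * dbes c y + bes c y)); first ring.
by rewrite ode mulr0 subr0.
Qed.

(** The refined energy [x * E + x * bes c * dbes c + (c - 1) / 2 * bes c ^+ 2],
    where [E] is the energy above, still decreases and dominates [x * bes c ^+ 2]
    because [x ^+ 2 * dbes c ^+ 2 + x * bes c * dbes c] is at least
    [- bes c ^+ 2 / 4]. *)
Lemma bes_decay c x : 3 / 2 <= c -> 0 <= x -> x * bes c x ^+ 2 <= (c - 1) / 2.
Proof.
move=> c2 x0; have c0 : 0 < c by apply: lt_le_trans c2; rewrite divr_gt0.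
pose W y := - (y * (bes c y ^+ 2 + y * dbes c y ^+ 2) + y * bes c y * dbes c y
               + (c - 1) / 2 * bes c y ^+ 2).
pose dW y := (2 * c - 3) * y * dbes c y ^+ 2.
suff : W 0 <= W x.
  rewrite /W !mul0r !add0r bes0 // expr1n mulr1; have := sqr_ge0 (x * dbes c x + bes c x / 2).
  have : 0 <= ((c - 1) / 2 - 1 / 4) * bes c x ^+ 2.
    by rewrite mulr_ge0 ?sqr_ge0 //; lra.
  lra.
apply: (@ge0_derive_ndecr R W dW) => // y y0; last first.
  by rewrite /dW mulr_ge0 ?sqr_ge0 // mulr_ge0 //; lra.
have d1 := is_derive_bes y c0; have [d d2 ode] := bes_ode y c0.
apply: is_derive_eq; rewrite /GRing.scale /= /dW.
transitivity ((2 * c - 3) * y * dbes c y ^+ 2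
  - (2 * y * dbes c y + bes c y) * (y * d + c * dbes c y + bes c y)); first by field.
by rewrite ode mulr0 subr0.
Qed.

End Bessel.

(** * The radial symbols and their asymptotics *)

Section Symbols.
Variables (R : realType) (a c : R).
Hypotheses (a0 : 0 < a) (c0 : 0 < c).
Implicit Types (x : R) (m : nat).

(** In dimension [n], with [a = (n + 2 - beta) / 2], [c = (n + 2) / 2] and
    [x = (|nu| delta / 2)^2], [dil_sym] is the 1F2 factor of the dilatation and
    [trans_sym] is the transverse eigenvalue up to the factor
    [- 4 mu / delta^2]; both are averages over the radius of Bessel functions,
    which is why they satisfy first order equations with [bes c] on the right. *)
Definition dil_coef m : R := a / (a + m%:R) * besc c m.
Definition defect_coef m : R := m.+1%:R^-1 * besc (c + 1) m.
Definition trans_coef m : R := a / ((a + m%:R) * m.+1%:R) * besc (c + 1) m.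

Definition dil_sym : R -> R := psum dil_coef.
Definition bes_defect x : R := c * (1 - bes c x).
Definition trans_sym x : R := x * psum trans_coef x.

Let am0 m : a + m%:R != 0. Proof. by rewrite lt0r_neq0 // ltr_wpDr. Qed.
Let m0 m : m.+1%:R != 0 :> R. Proof. by rewrite pnatr_eq0. Qed.
Let c10 : 0 < c + 1. Proof. exact: addr_gt0. Qed.

Let adiv_le1 m : `|a / (a + m%:R)| <= 1.
Proof.
rewrite ger0_norm ?divr_ge0 ?addr_ge0 ?(ltW a0) // ler_pdivrMr ?mul1r ?lerDl //.
by rewrite ltr_wpDr.
Qed.

Let minv_le1 m : `|m.+1%:R^-1 : R| <= 1.
Proof. by rewrite ger0_norm ?invr_ge0 // invf_le1 ?ltr0n // ler1n. Qed.

Lemma entire_dil : entire dil_coef.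
Proof. exact: entire_besc. Qed.

Lemma entire_defect : entire defect_coef.
Proof. exact: entire_besc. Qed.

Lemma entire_trans : entire trans_coef.
Proof.
apply: (@entire_besc _ _ 1) => // m; rewrite invfM mulrA normrM.
by rewrite -[leRHS]mulr1 ler_pM.
Qed.

Lemma dil_sym_ode x : exists2 d,
  is_derive x 1 dil_sym d & x * d + a * dil_sym x = a * bes c x.
Proof.
exists (psum (pseries_diffs dil_coef) x); first exact: is_derive_psum entire_dil.
rewrite psum_xderiv //; last exact: entire_dil.
rewrite -[psum _ x]mul1r -psumD; [|exact/entire_natM/entire_dil|exact: entire_dil].
rewrite -psumZ; last exact: entire_besc1.
congr (psum _ x); apply/funext => m; rewrite /dil_coef.
by have := am0 m => ?; field.
Qed.

Lemma psum_defectE x : x * psum defect_coef x = bes_defect x.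
Proof.
rewrite /bes_defect /bes [in RHS]psum_shift; last exact: entire_besc1.
have -> : besc c 0%N = 1 by rewrite /besc /pochhammer big_ord0 mul1r fact0 divr1.
have -> : psum defect_coef x = - c * psum (fun m => besc c m.+1) x.
  rewrite -psumZ; last exact/entire_shift/entire_besc1.
  congr (psum _ x); apply/funext => m; rewrite /defect_coef besc_succ //.
  by have := m0 m => ?; field.
ring.
Qed.

(** The average over radii seen as a differential equation; [bes_defect] is the
    transverse symbol of a single sphere, and it tends to [c]. *)
Lemma trans_sym_ode x : exists2 d,
  is_derive x 1 trans_sym d & x * d + (a - 1) * trans_sym x = a * bes_defect x.
Proof.
have d1 := is_derive_psum x entire_trans.
exists (psum trans_coef x + x * psum (pseries_diffs trans_coef) x).
  by apply: is_derive_eq; rewrite /GRing.scale /= mulr1 addrC.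
rewrite psum_xderiv //; last exact: entire_trans.
rewrite -psum_defectE [RHS]mulrCA -[a * psum defect_coef x]psumZ; last exact: entire_defect.
have -> : (fun m => a * defect_coef m) =
    (fun m => 1 * (m%:R * trans_coef m) + a * trans_coef m).
  apply/funext => m; rewrite /defect_coef /trans_coef.
  by have := m0 m => ?; have := am0 m => ?; field; rewrite nat1r m0.
rewrite psumD; [|exact/entire_natM/entire_trans|exact: entire_trans].
by rewrite /trans_sym; ring.
Qed.

(** Partial fractions: the longitudinal average is a combination of the
    transverse one and of [bes_defect]. This avoids a separate asymptotic analysis
    of the longitudinal part, whose own right-hand side oscillates without limit
    in dimension one. *)
Lemma psum_long_partE x :
  x * psum (fun m => (3 + 2 * m%:R) * trans_coef m) x =
  2 * a * bes_defect x + (3 - 2 * a) * trans_sym x.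
Proof.
rewrite -psum_defectE /trans_sym mulrCA [_ * (x * _)]mulrCA -mulrDr; congr (x * _).
rewrite -psumD; [|exact: entire_defect|exact: entire_trans].
congr (psum _ x); apply/funext => m; rewrite /defect_coef /trans_coef.
by have := m0 m => ?; have := am0 m => ?; field; rewrite nat1r m0.
Qed.

Hypothesis c32 : 3 / 2 <= c.

Lemma bes_small e : 0 < e -> exists2 X, 1 <= X &
  forall x, X <= x -> `|bes c x| <= e.
Proof.
move=> e0; exists (Num.max 1 ((c - 1) / (2 * e ^+ 2))); first by rewrite le_max lexx.
move=> x; rewrite ge_max => /andP[x1 xe]; have x0 : 0 < x by exact: lt_le_trans x1.
rewrite -ler_sqr ?nnegrE ?(ltW e0) // real_normK ?num_real //.
rewrite -(ler_pM2l x0); apply: le_trans (bes_decay c32 (ltW x0)) _.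
by move: xe; rewrite ler_pdivrMr ?mulr_gt0 ?exprn_gt0 // => h; lra.
Qed.

Hypothesis fpos : forall x, 0 < x -> 0 < trans_sym x.

Let th := Num.max 0 (1 - a).

(** Comparison with [k * x `^ th]: this power is a solution of the homogeneous
    equation when [a < 1], and a constant that a small [k] makes a subsolution when
    [1 <= a], because [bes_defect] is eventually at least [c / 2]. *)
Lemma trans_sym_lower : exists2 k, 0 < k &
  exists2 X, 1 <= X & forall x, X <= x -> k * x `^ th <= trans_sym x.
Proof.
have [|X X1 hX] := @bes_small (1 / 2); first by rewrite divr_gt0.
have X0 : 0 < X by exact: lt_le_trans X1.
have Xt0 : 0 < X `^ th by rewrite powR_gt0.
pose k := Num.min (trans_sym X / X `^ th) (a * c / (2 * (a + 1))).
have kp : 0 < k.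
  by rewrite lt_min !divr_gt0 ?fpos // ?mulr_gt0 ?addr_gt0.
exists k => //; exists X => // x Xx; rewrite -subr_ge0.
apply: (@euler_comparison R (a - 1) (fun y => trans_sym y - k * y `^ th) X) => //;
  last by rewrite subr_ge0 -ler_pdivlMr // ge_min lexx.
move=> y Xy; have y0 : 0 < y by exact: lt_le_trans Xy.
  have [d1 D1 E1] := trans_sym_ode y; have [d2 D2 E2] := is_derive_powR_euler th y0.
  exists (d1 - k * d2); first by apply: is_derive_eq; rewrite /GRing.scale.
  have -> : y * (d1 - k * d2) + (a - 1) * (trans_sym y - k * y `^ th) =
      a * bes_defect y - k * (th + a - 1) * y `^ th.
    rewrite -E1; transitivity (y * d1 - k * (y * d2) + (a - 1) * trans_sym y
      - (a - 1) * k * y `^ th); first ring.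
    rewrite E2; ring.
  have hh : c / 2 <= bes_defect y.
    rewrite /bes_defect; have := hX _ Xy; rewrite ler_norml => /andP[_ hy].
    by rewrite ler_wpM2l ?(ltW c0) //; lra.
  have [a1|a1] := ltP a 1.
    rewrite /th max_r ?subr_ge0 ?(ltW a1) // subrK subrr mulr0 mul0r .
    by rewrite mulr_ge0 ?(ltW a0) // (le_trans _ hh) // divr_ge0 ?(ltW c0).
  rewrite /th max_l ?subr_le0 // powRr0 mulr1 add0r subr_ge0.
  apply: (@le_trans _ _ (a * (c / 2))); last by rewrite ler_pM2l.
  apply: (@le_trans _ _ (k * (a + 1))).
    by rewrite ler_wpM2l ?(ltW kp) //; lra.
  have : k <= a * c / (2 * (a + 1)) by rewrite ge_min lexx orbT.
  by rewrite ler_pdivlMr ?mulr_gt0 ?addr_gt0 //; lra.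
Qed.

(** [bes c] itself decays too slowly in dimension one, but up to a factor it is a
    derivative: [bes (k + 1) = - k * dbes k]. Subtracting the resulting boundary term
    from [dil_sym] leaves a function [T] whose equation has a right-hand side of
    order [x^-1]; [T] is then compared with a supersolution [ps]. *)
Lemma dil_sym_bound : exists C, forall x, 1 <= x ->
  `|dil_sym x| <= C * x `^ (- Num.min 1 a).
Proof.
pose k := c - 1; have k2 : 2^-1 <= k by rewrite /k lerBrDr (le_trans _ c32) //; lra.
have k0 : 0 < k by apply: lt_le_trans k2; rewrite invr_gt0.
have ck : c = k + 1 by rewrite subrK.
have [ak akE ak0] : exists2 ak, ak = a * k & 0 < ak.
  by exists (a * k) => //; exact: mulr_gt0.
pose T x := dil_sym x + ak * (x^-1 * bes k x).
have bk (y : R) : 0 < y -> `|bes k y| <= 1.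
  by move=> y0; rewrite -ler_sqr ?nnegrE // real_normK ?num_real // expr1n
    bes_le1 // ltW.
have T_ode (y : R) : 0 < y -> exists2 d, is_derive y 1 T d &
    y * d + a * T y = ak * (a - 1) * (y^-1 * bes k y).
  move=> y0; have yn0 : y != 0 by rewrite gt_eqF.
  have [d1 D1 E1] := dil_sym_ode y; have D2 := is_derive_bes y k0.
  have D3 := is_derive_inv yn0.
  exists (d1 + ak * (- y ^- 2 * bes k y + y^-1 * dbes k y)).
    by apply: is_derive_eq; rewrite /GRing.scale /=; ring.
  rewrite /T; transitivity ((y * d1 + a * dil_sym y) + ak * (dbes k y
    + (a - 1) * (y^-1 * bes k y))); first by field.
  by rewrite E1 ck dbesE // akE; ring.
pose C := ak + `|T 1|.
have C0 : 0 <= C by rewrite addr_ge0 // ltW.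
have y1 (y : R) : 1 <= y -> 0 < y by exact: lt_le_trans.
have [ps ps_ode [ps1 psC]] : exists2 ps : R -> R, forall y : R, 1 <= y ->
    exists2 d, is_derive y 1 ps d &
      y * d + a * ps y >= ak * `|a - 1| * y^-1 &
    (ps 1 >= `|T 1| /\ forall y : R, 1 <= y -> ps y <= C * y `^ (- Num.min 1 a)).
  have [a1|a1] := leP 1 a.
    exists (fun y => C * y^-1) => [y /y1 yp|].
      have yn0 : y != 0 by rewrite gt_eqF.
      have D3 := is_derive_inv yn0.
      exists (C * - y ^- 2); first by apply: is_derive_eq.
      rewrite ger0_norm ?subr_ge0 //.
      have -> : y * (C * - y ^- 2) + a * (C * y^-1) = C * (a - 1) * y^-1 by field.
      rewrite ler_wpM2r ?invr_ge0 ?(ltW yp) // ler_wpM2r ?subr_ge0 //.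
      by rewrite lerDl.
    split=> [|y /y1 yp]; first by rewrite invr1 mulr1 lerDr ltW.
    by rewrite powRN powRr1 // ltW.
  (* for [a < 1] the homogeneous solution absorbs the right-hand side *)
  exists (fun y => C * y `^ (- a) - ak * y^-1) => [y /y1 yp|].
    have yn0 : y != 0 by rewrite gt_eqF.
    have D3 := is_derive_inv yn0.
    have [d2 D2 E2] := is_derive_powR_euler (- a) yp.
    exists (C * d2 - ak * - y ^- 2).
      by apply: is_derive_eq; rewrite /GRing.scale.
    rewrite ltr0_norm ?subr_lt0 //.
    rewrite [leRHS](_ : _ = C * (y * d2) + a * C * y `^ (- a)
       + ak * (1 - a) * y^-1); last by field.
    rewrite E2 -subr_ge0 [leRHS](_ : _ = 0) //; ring.
  split=> [|y /y1 yp]; first by rewrite invr1 powR1 /C; lra.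
  by rewrite gerBl mulr_ge0 ?invr_ge0 ?(ltW yp) ?(ltW ak0).
have Tps (y : R) : 1 <= y -> `|T y| <= ps y.
  move=> hy; rewrite ler_norml -subr_ge0 opprK -[T y <= _]subr_ge0.
  have aux (sg : R) : `|sg| = 1 -> forall z : R, 1 <= z -> 0 <= ps z + sg * T z.
    move=> sg1; apply: (@euler_comparison R a) => // [z z1|].
      have zp := y1 _ z1.
      have [d1 D1 E1] := T_ode _ zp; have [d2 D2 E2] := ps_ode _ z1.
      exists (d2 + sg * d1); first by apply: is_derive_eq.
      rewrite [leRHS](_ : _ = (z * d2 + a * ps z) + sg * (z * d1 + a * T z));
        last by ring.
      rewrite E1 -lerBlDr sub0r (le_trans _ E2) // (le_trans (ler_norm _)) //.
      rewrite normrN normrM sg1 mul1r !normrM (gtr0_norm ak0).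
      rewrite ler_wpM2l ?mulr_ge0 ?(ltW ak0) //.
      have zi : 0 < z^-1 by rewrite invr_gt0.
      by rewrite (gtr0_norm zi) ler_piMr ?(ltW zi) // bk.
    rewrite -lerBlDr sub0r (le_trans _ ps1) // (le_trans (ler_norm _)) //.
    by rewrite normrN normrM sg1 mul1r.
  have := aux 1 (normr1 _) y hy; have := aux (-1) (normrN1 _) y hy.
  by rewrite mulN1r mul1r [T y + _]addrC => -> ->.
exists (C + ak) => x x1; have xp := y1 _ x1.
have -> : dil_sym x = T x - ak * (x^-1 * bes k x) by rewrite /T addrK.
rewrite (le_trans (ler_normB _ _)) // mulrDl lerD //.
  exact: le_trans (Tps _ x1) (psC _ x1).
rewrite normrM (gtr0_norm ak0) ler_wpM2l ?(ltW ak0) //.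
have xi : 0 < x^-1 by rewrite invr_gt0.
rewrite normrM (gtr0_norm xi) (@le_trans _ _ x^-1) //.
  by rewrite ler_piMr ?(ltW xi) ?bk.
by rewrite -powR_inv1 ?(ltW xp) // ler_powR // lerN2 ge_min lexx.
Qed.

(** For [1 < a] the equation forces the limit [a * c / (a - 1)], the other
    solutions decaying like [x `^ (1 - a)]. *)
Lemma trans_sym_upper e : 1 < a -> 0 < e -> exists K, exists2 X, 1 <= X &
  forall x, X <= x -> trans_sym x <= a * c * (1 + e) / (a - 1) + K * x `^ (- (a - 1)).
Proof.
move=> a1 e0; have [X X1 hX] := bes_small e0.
have X0 : 0 < X by exact: lt_le_trans X1.
have am1 : 0 < a - 1 by rewrite subr_gt0.
exists (`|trans_sym X| * X `^ (a - 1)), X => // x Xx; rewrite -subr_ge0.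
apply: (@euler_comparison R (a - 1) (fun y => a * c * (1 + e) / (a - 1) +
  `|trans_sym X| * X `^ (a - 1) * y `^ (- (a - 1)) - trans_sym y) X) => // [y Xy|].
  have y0 : 0 < y by exact: lt_le_trans Xy.
  have [d1 D1 E1] := trans_sym_ode y.
  have [d2 D2 E2] := is_derive_powR_euler (- (a - 1)) y0.
  exists (`|trans_sym X| * X `^ (a - 1) * d2 - d1).
    by apply: is_derive_eq; rewrite /GRing.scale /= add0r mul1r.
  set K := `|_| * _.
  rewrite [leRHS](_ : _ = a * c * (1 + e) + K * (y * d2 + (a - 1) * y `^ (- (a - 1)))
     - (y * d1 + (a - 1) * trans_sym y)); last by field; rewrite gt_eqF.
  rewrite E1 E2 mulNr addNr mulr0 addr0 /bes_defect mulrA -mulrBr.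
  rewrite mulr_ge0 ?mulr_ge0 ?(ltW a0) ?(ltW c0) //.
  have := hX _ Xy; rewrite ler_norml => /andP[h _]; lra.
rewrite -[`|_| * _ * _]mulrA -powRD ?subrr ?powRr0; last by rewrite (gt_eqF X0) implybT.
rewrite mulr1 -addrA addr_ge0 //; last by rewrite subr_ge0 ler_norm.
by rewrite divr_ge0 ?(ltW am1) // !mulr_ge0 ?(ltW a0) ?(ltW c0) ?addr_ge0 ?(ltW e0).
Qed.

(** The two terms of the sum are nonnegative for [a <= 3 / 2], and then one of
    them alone has the right size. For larger [a] they compete, but the limits of
    both are known and the sum tends to [a * c / (a - 1)], which is positive. *)
Lemma long_part_lower : exists2 k, 0 < k & exists2 X, 1 <= X &
  forall x, X <= x -> k * x `^ th <= 2 * a * bes_defect x + (3 - 2 * a) * trans_sym x.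
Proof.
have [k k0 [X X1 hf]] := trans_sym_lower.
have [|Y Y1 hY] := @bes_small (1 / 2); first by rewrite divr_gt0.
have hh x : Y <= x -> c / 2 <= bes_defect x.
  move=> Yx; rewrite /bes_defect; have := hY _ Yx; rewrite ler_norml => /andP[_ hy].
  rewrite -subr_ge0 -mulrBr mulr_ge0 ?(ltW c0) //; lra.
have M1 : 1 <= Num.max X Y by rewrite le_max X1.
have [a1|a1] := leP a 1.
  exists k => //; exists (Num.max X Y) => // x; rewrite ge_max => /andP[Xx Yx].
  apply: le_trans (hf _ Xx) _; have x0 : 0 < x by apply: lt_le_trans Xx; apply: lt_le_trans X1.
  have := fpos x0; have := hh _ Yx => h1 f0.
  have : 0 <= a * bes_defect x.
    by rewrite mulr_ge0 ?(ltW a0) // (le_trans _ h1) // divr_ge0 ?(ltW c0).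
  have : 0 <= (2 - 2 * a) * trans_sym x by rewrite mulr_ge0 ?(ltW f0) //; lra.
  lra.
have thE : th = 0 by rewrite /th max_l // subr_le0 ltW.
have ac0 : 0 < a * c by rewrite mulr_gt0.
have [a32|a32] := leP a (3 / 2).
  exists (a * c) => //; exists (Num.max X Y) => // x; rewrite ge_max => /andP[Xx Yx].
  rewrite thE powRr0 mulr1; have x0 : 0 < x by apply: lt_le_trans Xx; apply: lt_le_trans X1.
  have : 0 <= a * (bes_defect x - c / 2) by rewrite mulr_ge0 ?(ltW a0) ?subr_ge0 ?hh.
  have : 0 <= (3 - 2 * a) * trans_sym x by rewrite mulr_ge0 ?(ltW (fpos x0)) //; lra.
  lra.
(* [e * (4 * a - 5) <= 1 / 2] keeps half of the limit [a * c / (a - 1)] *)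
pose e := (8 * a)^-1; have e0 : 0 < e by rewrite invr_gt0 mulr_gt0.
have [K [Z Z1 hZ]] := trans_sym_upper a1 e0; have [W W1 hW] := bes_small e0.
have am1 : 0 < a - 1 by rewrite subr_gt0.
pose q := a * c / (4 * (a - 1)).
have q0 : 0 < q by rewrite divr_gt0 // mulr_gt0.
have K0 : 0 < (2 * a - 3) * `|K| + 1 by rewrite ltr_wpDl // mulr_ge0 //; lra.
have [V V1 hV] := powR_small am1 (divr_gt0 q0 K0).
exists q => //; exists (Num.max Z (Num.max W V)); first by rewrite le_max Z1.
move=> x; rewrite !ge_max => /and3P[Zx Wx Vx]; rewrite thE powRr0 mulr1.
have h1 : a * c * (1 - e) <= a * bes_defect x.
  rewrite /bes_defect mulrA ler_wpM2l ?(ltW ac0) //.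
  by have := hW _ Wx; rewrite ler_norml => /andP[_ ?]; lra.
have p0 := powR_ge0 x (- (a - 1)).
have h2 : (2 * a - 3) * trans_sym x <=
    (2 * a - 3) * (a * c * (1 + e) / (a - 1)) + q.
  apply: (@le_trans _ _ ((2 * a - 3) * (a * c * (1 + e) / (a - 1)
      + `|K| * x `^ (- (a - 1))))).
    rewrite ler_wpM2l //; first by lra.
    by apply: le_trans (hZ _ Zx) _; rewrite lerD2l ler_wpM2r // ler_norm.
  rewrite mulrDr lerD2l mulrA; have := hV _ Vx; rewrite ler_pdivlMr // => hq.
  by apply: le_trans hq; rewrite mulrC ler_wpM2l // lerDl.
have e8 : 8 * a * e = 1 by rewrite mulfV // mulf_neq0 // gt_eqF.
suff : 2 * q <= 2 * (a * c * (1 - e)) - (2 * a - 3) * (a * c * (1 + e) / (a - 1)).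
  lra.
have -> : 2 * (a * c * (1 - e)) - (2 * a - 3) * (a * c * (1 + e) / (a - 1))
   = a * c / (a - 1) * (1 - e * (4 * a - 5)) by field; rewrite gt_eqF.
have -> : 2 * q = a * c / (a - 1) * 2^-1 by rewrite /q; field; rewrite gt_eqF.
rewrite ler_wpM2l ?divr_ge0 ?(ltW ac0) ?(ltW am1) //.
lra.
Qed.

End Symbols.

(** * Hypergeometric series *)

Section Hypergeometric.
Variable R : realType.

Lemma pochhammer_ratio (p : R) m : 0 < p ->
  pochhammer p m / pochhammer (p + 1) m = p / (p + m%:R).
Proof.
move=> p0; have p10 := addr_gt0 p0 ltr01.
have h1 := lt0r_neq0 (pochhammer_gt0 m p10).
have h2 : p + m%:R != 0 by rewrite lt0r_neq0 // ltr_wpDr.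
apply/eqP; rewrite eqr_div //; apply/eqP.
by rewrite -pochhammerSr pochhammerSl.
Qed.

(** The hypergeometric series at a negative argument as a power series in its
    opposite, the sign being absorbed in the coefficients. *)
Lemma pFq_psum (A B : seq R) x : pFq A B (- x) =
  psum (fun m => (\prod_(c <- A) pochhammer c m) / (\prod_(c <- B) pochhammer c m)
     * ((-1) ^+ m / m`!%:R)) x.
Proof.
congr (limn (series _)); apply/funext => m.
by rewrite /= [in LHS]exprNn -!mulrA [x ^+ m * _]mulrC.
Qed.

Variables (a c : R).
Hypotheses (a0 : 0 < a) (c0 : 0 < c).

Lemma pFq_dil x : pFq [:: a] [:: c; a + 1] (- x) = dil_sym a c x.
Proof.
rewrite pFq_psum; congr (psum _ x); apply/funext => m.
rewrite !big_cons !big_nil !mulr1 /dil_coef /besc -pochhammer_ratio //.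
by rewrite !invfM; ring.
Qed.

Lemma pFq_trans x :
  x * pFq [:: 1; a] [:: 2; c + 1; a + 1] (- x) = trans_sym a c x.
Proof.
rewrite pFq_psum; congr (_ * psum _ x); apply/funext => m.
rewrite !big_cons !big_nil !mulr1 /trans_coef /besc.
have -> : a / ((a + m%:R) * m.+1%:R) = a / (a + m%:R) / m.+1%:R.
  by rewrite invfM mulrA.
rewrite -pochhammer_ratio //.
have -> : m.+1%:R^-1 = pochhammer 1 m / pochhammer 2 m :> R.
  by rewrite (_ : 2 = 1 + 1) // pochhammer_ratio // nat1r mul1r.
by rewrite !invfM; ring.
Qed.

Lemma pFq_long_part x :
  x * (3 * pFq [:: 1; 5 / 2; a] [:: 2; 3 / 2; c + 1; a + 1] (- x)) =
  2 * a * bes_defect c x + (3 - 2 * a) * trans_sym a c x.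
Proof.
rewrite -psum_long_partE //; congr (_ * _); rewrite pFq_psum.
set cf := fun m => _ / _ * _.
have coefE m : (1 + 2 / 3 * m%:R) * trans_coef a c m = cf m.
  rewrite /cf !big_cons !big_nil !mulr1 /trans_coef /besc.
  have -> : a / ((a + m%:R) * m.+1%:R) = a / (a + m%:R) / m.+1%:R.
    by rewrite invfM mulrA.
  rewrite -pochhammer_ratio //.
  have -> : m.+1%:R^-1 = pochhammer 1 m / pochhammer 2 m :> R.
    by rewrite (_ : 2 = 1 + 1) // pochhammer_ratio // nat1r mul1r.
  have -> : 1 + 2 / 3 * m%:R = pochhammer (5 / 2) m / pochhammer (3 / 2) m :> R.
    rewrite -[RHS]invrK invf_div (_ : 5 / 2 = 3 / 2 + 1); last by field.
    have h : 0 < 3 / 2 :> R by rewrite divr_gt0.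
    by rewrite pochhammer_ratio // invf_div; field.
  by rewrite !invfM; ring.
rewrite -psumZ; last first.
  have : entire (fun m => 1 * trans_coef a c m + (2 / 3) * (m%:R * trans_coef a c m)).
    by apply: entireD; [|apply: entire_natM]; exact: entire_trans.
  congr entire; apply/funext => m; rewrite -coefE; field.
  by apply/eqP.
congr (psum _ x); apply/funext => m; rewrite -coefE; by field.
Qed.

End Hypergeometric.

(** * Lower bound of the multipliers *)

Section PositiveLower.
Variables (R : realType) (g : R -> R) (k X x1 th : R).
Hypotheses (k0 : 0 < k) (th0 : 0 <= th) (x10 : 0 < x1).
Hypothesis dg : forall x, derivable g x 1.
Hypothesis gpos : forall x, 0 < x -> 0 < g x.
Hypothesis gX : forall x, X <= x -> k * x `^ th <= g x.

(** Compactness takes care of the range between [x1] and the range where the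
    asymptotics applies. *)
Lemma positive_lower : exists2 kk, 0 < kk & forall x, x1 <= x -> kk * x `^ th <= g x.
Proof.
pose Y := Num.max x1 X.
have Y0 : 0 < Y by rewrite lt_max x10.
have Yt0 : 0 < Y `^ th by rewrite powR_gt0.
have x1Y : x1 <= Y by rewrite le_max lexx.
have [z] : exists2 z, z \in `[x1, Y] & forall t, t \in `[x1, Y] -> g z <= g t.
  by apply: EVT_min => //; apply: derivable_within_continuous => y _; exact: dg.
rewrite in_itv /= => /andP[x1z _] zmin.
have gz : 0 < g z by rewrite gpos // (lt_le_trans x10).
exists (Num.min k (g z / Y `^ th)); first by rewrite lt_min k0 divr_gt0.
move=> x x1x; have x0 : 0 < x by exact: lt_le_trans x1x.
have [xY|Yx] := leP x Y.
  have zx : g z <= g x by rewrite zmin // in_itv /= x1x.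
  apply: le_trans zx; apply: (@le_trans _ _ (g z / Y `^ th * x `^ th)).
    by rewrite ler_wpM2r ?powR_ge0 // ge_min lexx orbT.
  rewrite mulrAC ler_pdivrMr // ler_wpM2l ?(ltW gz) //.
  by rewrite ge0_ler_powR ?nnegrE ?(ltW x0) ?(ltW Y0).
apply: le_trans (gX _); last by rewrite (le_trans _ (ltW Yx)) // le_max lexx orbT.
by rewrite ler_wpM2r ?powR_ge0 // ge_min lexx.
Qed.

End PositiveLower.

Section LambdaLower.
Variables (R : realType) (n : nat) (delta beta mu lams : R).
Hypotheses (hn : (1 <= n)%N) (hdelta : 0 < delta) (hbeta : beta < n%:R + 2)
  (hmu : 0 < mu).
Hypothesis hlambda1 : forall nu : 'cV[R]_n, nu != 0 ->
  lambda1 delta beta mu lams nu < 0.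
Hypothesis hlambda2 : forall nu : 'cV[R]_n, nu != 0 ->
  lambda2 delta beta mu nu < 0.

Let a : R := (n%:R + 2 - beta) / 2.
Let c : R := (n%:R + 2) / 2.

Let a0 : 0 < a. Proof. by rewrite divr_gt0 ?subr_gt0. Qed.
Let c32 : 3 / 2 <= c.
Proof.
rewrite /c ler_pM2r ?invr_gt0 //.
have : 1%:R <= n%:R :> R by rewrite ler_nat.
lra.
Qed.
Let c0 : 0 < c. Proof. by apply: lt_le_trans c32; rewrite divr_gt0. Qed.

Let X (nu : 'cV[R]_n) : R := 1 / 4 * enormsq nu * delta ^+ 2.

Let XE nu : - (1 / 4) * enormsq nu * delta ^+ 2 = - X nu.
Proof. by rewrite /X; ring. Qed.

Let c1E : (n%:R + 4) / 2 = c + 1 :> R. Proof. by rewrite /c; field. Qed.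
Let a1E : (n%:R + 4 - beta) / 2 = a + 1. Proof. by rewrite /a; field. Qed.

Let dn0 : delta != 0. Proof. by rewrite gt_eqF. Qed.

Let lambda2E nu :
  lambda2 delta beta mu nu = - (4 / delta ^+ 2) * (mu * trans_sym a c (X nu)).
Proof.
rewrite /lambda2 XE c1E a1E -/a -pFq_trans //.
by rewrite /X; field.
Qed.

Definition long_sym x : R :=
  mu * (2 * a * bes_defect c x + (3 - 2 * a) * trans_sym a c x)
  + (lams - mu) * (x * dil_sym a c x ^+ 2).

Let lambda1E nu :
  lambda1 delta beta mu lams nu = - (4 / delta ^+ 2) * long_sym (X nu).
Proof.
rewrite /lambda1 /long_sym XE c1E a1E -/a -/c -pFq_dil // -pFq_long_part //.
by rewrite /X; field.
Qed.

Let nuX x : 0 < x -> exists2 nu : 'cV[R]_n, nu != 0 & X nu = x.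
Proof.
move=> x0; pose j : 'I_n := Ordinal hn.
pose nu : 'cV[R]_n := Num.sqrt (4 * x / delta ^+ 2) *: delta_mx j 0.
have p : 0 < 4 * x / delta ^+ 2 by rewrite divr_gt0 ?mulr_gt0 // exprn_gt0.
have e : enormsq nu = 4 * x / delta ^+ 2.
  rewrite /enormsq (bigD1 j) //= big1 ?addr0 => [|i /negbTE ij].
    by rewrite !mxE !eqxx mulr1 sqr_sqrtr // ltW.
  by rewrite !mxE ij mulr0 expr0n.
exists nu; first by rewrite -enormsq_eq0 e gt_eqF.
by rewrite /X e; field.
Qed.

Let d0 : 0 < 4 / delta ^+ 2. Proof. by rewrite divr_gt0 // exprn_gt0. Qed.

(** Every positive [x] comes from some vector, so the sign hypotheses on the
    eigenvalues become positivity of one-variable functions. *)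
Let fpos x : 0 < x -> 0 < trans_sym a c x.
Proof.
move=> /nuX[nu nu0 <-]; have := hlambda2 nu0; rewrite lambda2E mulNr oppr_lt0.
by rewrite (pmulr_rgt0 _ d0) (pmulr_rgt0 _ hmu).
Qed.

Let lpos x : 0 < x -> 0 < long_sym x.
Proof.
move=> /nuX[nu nu0 <-]; have := hlambda1 nu0; rewrite lambda1E mulNr oppr_lt0.
by rewrite (pmulr_rgt0 _ d0).
Qed.

Let th : R := Num.max 0 (1 - a).

Let dtrans_sym x : derivable (trans_sym a c) x 1.
Proof. by have [d [? _] _] := trans_sym_ode a0 c0 x. Qed.

Let dlong x : derivable long_sym x 1.
Proof.
have [d1 D1 _] := trans_sym_ode a0 c0 x; have [d2 D2 _] := dil_sym_ode a0 c0 x.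
have D3 := is_derive_bes x c0.
have [d D] : exists d, is_derive x 1 long_sym d.
  by eexists; rewrite /long_sym /bes_defect; apply: is_derive_eq; reflexivity.
by case: D.
Qed.

(** The squared term is of lower order: [x * dil_sym ^+ 2] is at most of order
    [x `^ (1 - 2 * Num.min 1 a)], whereas the main term is of order at least
    [x `^ (1 - Num.min 1 a)]. So the main term
    prevails whatever the sign of [lams - mu]. *)
Let long_eventually : exists2 k, 0 < k & exists X0,
  forall x, X0 <= x -> k * x `^ th <= long_sym x.
Proof.
have [k k0 [X1 X11 hX1]] := long_part_lower a0 c0 c32 fpos.
have [C hC] := dil_sym_bound a0 c0 c32.
pose m := Num.min 1 a; have m0 : 0 < m by rewrite lt_min ltr01.
have thE : th = 1 - m.
  rewrite /th /m; have [a1|a1] := leP a 1.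
    by rewrite max_r ?min_r // subr_ge0.
  by rewrite max_l ?min_l ?subrr ?(ltW a1) // subr_le0 ltW.
have D0 : 0 < `|lams - mu| * C ^+ 2 + 1.
  by rewrite ltr_wpDl // mulr_ge0 // sqr_ge0.
have k20 : 0 < mu * k / 2 by rewrite divr_gt0 // mulr_gt0.
have [X2 X21 hX2] := powR_small m0 (divr_gt0 k20 D0).
exists (mu * k / 2) => //; exists (Num.max X1 X2) => x; rewrite ge_max => /andP[h1 h2].
have x1 : 1 <= x by exact: le_trans X11 h1.
have x0 : 0 < x by exact: lt_le_trans x1.
have xn0 : x != 0 by rewrite gt_eqF.
have hS : x * dil_sym a c x ^+ 2 <= C ^+ 2 * x `^ (- m) * x `^ th.
  have := hC _ x1; rewrite -/m => hS.
  have : `|dil_sym a c x| ^+ 2 <= (C * x `^ (- m)) ^+ 2.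
    by rewrite lerXn2r ?nnegrE // (le_trans _ hS).
  rewrite real_normK ?num_real // => hS2.
  apply: (le_trans (ler_wpM2l (ltW x0) hS2)).
  rewrite thE powRD; last by rewrite xn0 implybT.
  rewrite powRr1 ?(ltW x0) //.
  by rewrite le_eqVlt; apply/orP; left; apply/eqP; ring.
have hk := hX1 _ h1; rewrite -/th in hk.
have t0 := powR_ge0 x th.
have : `|(lams - mu) * (x * dil_sym a c x ^+ 2)| <= mu * k / 2 * x `^ th.
  rewrite normrM (ger0_norm (mulr_ge0 (ltW x0) (sqr_ge0 _))).
  apply: (le_trans (ler_wpM2l (normr_ge0 _) hS)).
  rewrite mulrA ler_wpM2r // mulrA.
  have := hX2 _ h2; rewrite ler_pdivlMr // => hm; apply: le_trans hm.
  by rewrite mulrC ler_wpM2l ?powR_ge0 // lerDl.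
rewrite ler_norml => /andP[hl _]; rewrite /long_sym.
have : mu * (k * x `^ th) <= mu * (2 * a * bes_defect c x + (3 - 2 * a) * trans_sym a c x).
  by rewrite ler_wpM2l // ltW.
lra.
Qed.

(** The quantitative content of the multiplier formulas: away from the origin
    the inverse of the multiplier gains [max 0 (beta - n)] derivatives, since
    [1 - a = (beta - n) / 2] and the weight is quadratic in the frequency. *)
Lemma lambda_lower : exists2 k, 0 < k &
  forall nu : 'cV[R]_n, 1 <= enormsq nu ->
    k * (1 + enormsq nu) `^ th <= - lambda1 delta beta mu lams nu
    /\ k * (1 + enormsq nu) `^ th <= - lambda2 delta beta mu nu.
Proof.
have th0 : 0 <= th by rewrite le_max lexx.
have x10 : 0 < delta ^+ 2 / 4 by rewrite divr_gt0 // exprn_gt0.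
have [k1 k10 h1] : exists2 k, 0 < k &
    forall x, delta ^+ 2 / 4 <= x -> k * x `^ th <= long_sym x.
  have [k k0 [X0 hX]] := long_eventually.
  exact: positive_lower k0 th0 x10 dlong lpos hX.
have [k2 k20 h2] : exists2 k, 0 < k &
    forall x, delta ^+ 2 / 4 <= x -> k * x `^ th <= trans_sym a c x.
  have [k k0 [X0 _ hX]] := trans_sym_lower a0 c0 c32 fpos.
  exact: positive_lower k0 th0 x10 dtrans_sym fpos hX.
pose q := (delta ^+ 2 / 8) `^ th.
have q0 : 0 < q by rewrite powR_gt0 // divr_gt0 // exprn_gt0.
exists (4 / delta ^+ 2 * (Num.min k1 (mu * k2) * q)).
  by rewrite mulr_gt0 // mulr_gt0 // lt_min k10 mulr_gt0.
move=> nu nu1; have Xx1 : delta ^+ 2 / 4 <= X nu.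
  rewrite -subr_ge0 (_ : _ - _ = delta ^+ 2 / 4 * (enormsq nu - 1)).
    by rewrite mulr_ge0 ?(ltW x10) // subr_ge0.
  by rewrite /X; field.
have key : q * (1 + enormsq nu) `^ th <= X nu `^ th.
  have w0 : 0 <= 1 + enormsq nu by lra.
  have X0 : 0 <= X nu by apply: le_trans Xx1; rewrite ltW.
  rewrite /q -powRM //; last by rewrite divr_ge0 ?sqr_ge0.
  have w1 : 0 <= delta ^+ 2 / 8 * (1 + enormsq nu).
    by rewrite mulr_ge0 // divr_ge0 ?sqr_ge0.
  rewrite ge0_ler_powR // -subr_ge0.
  rewrite (_ : _ - _ = delta ^+ 2 / 8 * (enormsq nu - 1)).
    by rewrite mulr_ge0 ?divr_ge0 ?sqr_ge0 // subr_ge0.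
  by rewrite /X; field.
rewrite lambda1E lambda2E !mulNr !opprK.
have scale A : Num.min k1 (mu * k2) * (q * (1 + enormsq nu) `^ th) <= A ->
    4 / delta ^+ 2 * (Num.min k1 (mu * k2) * q) * (1 + enormsq nu) `^ th
    <= 4 / delta ^+ 2 * A.
  by move=> hA; rewrite -mulrA ler_wpM2l ?(ltW d0) // -mulrA.
have m0 : 0 <= Num.min k1 (mu * k2).
  by rewrite le_min (ltW k10) mulr_ge0 ?(ltW hmu) ?(ltW k20).
have t0 := powR_ge0 (X nu) th.
have kl := ler_wpM2l m0 key.
split; apply: scale.
  apply: le_trans kl (le_trans _ (h1 _ Xx1)).
  by rewrite ler_wpM2r // ge_min lexx.
apply: le_trans kl (le_trans (ler_wpM2r t0 (_ : _ <= mu * k2)) _).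
  by rewrite ge_min lexx orbT.
by rewrite -mulrA ler_pM2l // h2.
Qed.

End LambdaLower.

(** * Complex exponentials *)

Section Cis.
Variable R : realType.
Implicit Types (x y : R) (z : R[i]).

Lemma normc_ge0 z : 0 <= normc z.
Proof. by case: z => a b; exact: sqrtr_ge0. Qed.

Lemma normc_real x : normc x%:C = `|x|.
Proof. by rewrite /normc /= expr0n addr0 sqrtr_sqr. Qed.

Lemma normc_le_ReIm z : normc z <= `|complex.Re z| + `|complex.Im z|.
Proof.
case: z => a b /=; rewrite -ler_sqr ?nnegrE ?sqrtr_ge0 ?addr_ge0 //.
rewrite sqr_sqrtr ?addr_ge0 ?sqr_ge0 // sqrrD !real_normK ?num_real //.
by rewrite -addrAC lerDl mulrn_wge0 // mulr_ge0.
Qed.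

Lemma Re_le_normc z : `|complex.Re z| <= normc z.
Proof.
case: z => a b /=; rewrite -ler_sqr ?nnegrE ?sqrtr_ge0 //.
by rewrite sqr_sqrtr ?addr_ge0 ?sqr_ge0 // real_normK ?num_real // lerDl sqr_ge0.
Qed.

Lemma Im_le_normc z : `|complex.Im z| <= normc z.
Proof.
case: z => a b /=; rewrite -ler_sqr ?nnegrE ?sqrtr_ge0 //.
by rewrite sqr_sqrtr ?addr_ge0 ?sqr_ge0 // real_normK ?num_real // lerDr sqr_ge0.
Qed.

Lemma le_normc_sum (I : Type) (r : seq I) (P : pred I) (F : I -> R[i]) :
  normc (\sum_(i <- r | P i) F i) <= \sum_(i <- r | P i) normc (F i).
Proof.
elim/big_rec2: _ => [|i y z _ IH]; first by rewrite normc0.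
by rewrite (le_trans (le_normcD _ _)) // lerD2l.
Qed.

Definition cis x : R[i] := cos x +i* sin x.

Lemma cis0 : cis 0 = 1. Proof. by rewrite /cis cos0 sin0. Qed.

Lemma cisD x y : cis (x + y) = cis x * cis y.
Proof. by rewrite /cis cosD sinD; simpc; congr (_ +i* _); rewrite addrC. Qed.

Lemma normc_cis x : normc (cis x) = 1.
Proof. by rewrite /normc /cis cos2Dsin2 sqrtr1. Qed.

Lemma cis_sum (I : Type) (r : seq I) (F : I -> R) :
  cis (\sum_(i <- r) F i) = \prod_(i <- r) cis (F i).
Proof. by elim/big_rec2: _ => [|i y z _ <-]; rewrite ?cis0 ?cisD. Qed.

Lemma cisMn x m : cis (m%:R * x) = cis x ^+ m.
Proof.
elim: m => [|m IH]; first by rewrite mul0r cis0.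
by rewrite -natr1 mulrDl mul1r cisD IH exprSr.
Qed.

Lemma cisD2piz x (m : int) : cis (x + m%:~R * (pi *+ 2)) = cis x.
Proof. by rewrite /cis cosD2piz sinD2piz. Qed.

Lemma normc_cisB1 x : normc (cis x - 1) = 2 * `|sin (x / 2)|.
Proof.
have -> : cis x - 1 = (cos x - 1) +i* sin x 
  by apply/eqP; rewrite eq_complex /= oppr0 addr0 !eqxx.
rewrite /normc -[RHS]ger0_norm ?mulr_ge0 // -sqrtr_sqr; congr Num.sqrt.
rewrite exprMn real_normK ?num_real //.
have e : x = (x / 2) *+ 2 by rewrite -mulr_natr divfK.
rewrite {1}e {2}e cos_mulr2n sin_mulr2n.
have := cos2Dsin2 (x / 2); set c := cos _; set s := sin _ => h.
have -> : s ^+ 2 = 1 - c ^+ 2 by rewrite -h addrAC subrr add0r.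
have -> : (c * s *+ 2) ^+ 2 = 4 * c ^+ 2 * s ^+ 2 by rewrite -mulr_natr; ring.
have -> : s ^+ 2 = 1 - c ^+ 2 by rewrite -h addrAC subrr add0r.
by rewrite -mulr_natr; ring.
Qed.

Lemma sin_ge_Mcos y : 0 <= y <= pi / 2 -> y * cos y <= sin y.
Proof.
move=> /andP[y0 y2]; have pi0 := pi_ge0 R.
have [|z] := @MVT_segment R sin cos 0 y y0.
  exact/continuous_subspaceT/continuous_sin.
rewrite in_itv /= => /andP[z0 zy].
rewrite sin0 !subr0 mulrC => ->; rewrite ler_wpM2l //.
rewrite leNgt; apply/negP => h.
have zpi : z \in `[0, pi]%R by rewrite in_itv /= z0; lra.
have ypi : y \in `[0, pi]%R by rewrite in_itv /= y0; lra.
by move: h; rewrite ltr_cos // ltNge zy.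
Qed.

(** With [sin x = 2 sin (x / 2) cos (x / 2)] and [x / 2 * cos (x / 2) <= sin (x / 2)],
    [sin x] is at least [x * cos (x / 2) ^+ 2], which is [x * (1 + cos x) / 2]. *)
Lemma sin_ge_half x : 0 <= x <= pi / 2 -> x / 2 <= sin x.
Proof.
move=> /andP[x0 x2]; have pi0 := pi_ge0 R.
have h : (x / 2) * cos (x / 2) <= sin (x / 2) by rewrite sin_ge_Mcos; lra.
have c0 : 0 <= cos (x / 2) by apply: cos_ge0_pihalf; lra.
have cx : 0 <= cos x by apply: cos_ge0_pihalf; lra.
have e : x = (x / 2) *+ 2 by rewrite -mulr_natr divfK.
have hs : sin x = cos (x / 2) * sin (x / 2) * 2 by rewrite {1}e sin_mulr2n mulr_natr.
have hc : cos x = cos (x / 2) ^+ 2 * 2 - 1 by rewrite {1}e cos_mulr2n mulr_natr.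
rewrite hc in cx; rewrite hs.
have := ler_wpM2l c0 h.
have : 0 <= (x / 2) * (cos (x / 2) ^+ 2 * 2 - 1).
  by rewrite mulr_ge0 // divr_ge0.
lra.
Qed.

(** The chord is comparable to the arc; this is what lets difference quotients
    on the grid control every frequency of the box. *)
Lemma cisB1_ge x : `|x| <= pi -> `|x| / 2 <= normc (cis x - 1).
Proof.
move=> xpi; rewrite normc_cisB1.
have -> : `|sin (x / 2)| = `|sin (`|x| / 2)|.
  by case: (ger0P x) => // _; rewrite mulNr sinN normrN.
have h : `|x| / 2 / 2 <= sin (`|x| / 2).
  by apply: sin_ge_half; rewrite divr_ge0 //= ler_pM2r.
apply: (@le_trans _ _ (2 * sin (`|x| / 2))); first lra.
by rewrite ler_wpM2l // ler_norm.
Qed.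

Lemma cis_neq1 x : 0 < `|x| -> `|x| < pi *+ 2 -> cis x != 1.
Proof.
move=> x0 x2; rewrite -subr_eq0; apply/eqP => /(congr1 (@normc R)).
rewrite normc0 normc_cisB1 => /eqP; rewrite mulf_eq0 pnatr_eq0 /= normr_eq0.
have -> : (sin (x / 2) == 0) = (sin (`|x| / 2) == 0).
  by case: (ger0P x) => // _; rewrite mulNr sinN oppr_eq0.
rewrite gt_eqF //; apply: sin_gt0_pi; rewrite divr_gt0 //=.
by rewrite ltr_pdivrMr // mulr_natr.
Qed.

End Cis.

(** * The finite Fourier transform on a grid *)

Section Grid.
Variables (R : realType) (n K : nat).

Definition grid_size := K.*2.+1.
(** The grid has an odd number [2 K + 1] of points in each direction so that its
    frequencies fill the symmetric box of radius [K]. *)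
Definition grid := {ffun 'I_n -> 'I_grid_size}.
Definition grid_step : R := pi *+ 2 / grid_size%:R.
Definition grid_pt (t : grid) : 'cV[R]_n := \col_j (grid_step * (t j)%:R).
Definition grid_freq (k : grid) : 'cV[int]_n := \col_j ((k j)%:Z - K%:Z).

Lemma grid_size_neq0 : grid_size%:R != 0 :> R. Proof. by rewrite pnatr_eq0. Qed.

Lemma grid_step_gt0 : 0 < grid_step.
Proof. by rewrite divr_gt0 ?ltr0n // -mulr_natr mulr_gt0 ?pi_gt0. Qed.

Lemma grid_sizeM : grid_size%:R * grid_step = pi *+ 2.
Proof. by rewrite mulrC divfK // grid_size_neq0. Qed.

Lemma roots_of_unity_sum (d : int) : (`|d| < grid_size)%N ->
  \sum_(m < grid_size) cis (grid_step * d%:~R * m%:R) = if d == 0 then grid_size%:R else 0.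
Proof.
move=> dN; case: eqP => [->|/eqP d0].
  under eq_bigr do rewrite mulr0 mul0r cis0.
  by rewrite sumr_const card_ord.
have z1 : cis (grid_step * d%:~R) != 1.
  apply: cis_neq1; rewrite normrM (gtr0_norm grid_step_gt0).
    by rewrite mulr_gt0 ?grid_step_gt0 // normr_gt0 intr_eq0.
  rewrite -grid_sizeM mulrC ltr_pM2r ?grid_step_gt0 //.
  by rewrite -intr_norm -[X in _ < X]/(grid_size%:~R) ltr_int.
under eq_bigr do rewrite mulrC cisMn.
apply/eqP; rewrite -(mulrI_eq0 _ (mulfI (x := cis (grid_step * d%:~R) - 1) _)) ?subr_eq0 //.
rewrite -subrX1 subr_eq0 -cisMn mulrA grid_sizeM mulrC.
by rewrite -[_ * _]add0r cisD2piz cis0.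
Qed.

(** Expanding the exponential of a sum turns the sum over the grid into a product of
    geometric sums of roots of unity. *)
Lemma grid_orthogonality (d : 'I_n -> int) : (forall j, (`|d j| < grid_size)%N) ->
  \sum_(t : grid) cis (\sum_j grid_step * (d j)%:~R * (t j)%:R) =
  if [forall j, d j == 0] then grid_size%:R ^+ n else 0.
Proof.
move=> dN; under eq_bigr do rewrite cis_sum.
rewrite -(bigA_distr_bigA (fun j (m : 'I_grid_size) => cis (grid_step * (d j)%:~R * m%:R))).
under eq_bigr do rewrite roots_of_unity_sum //.
case: ifP => [/forallP d0|/negbT].
  under eq_bigr do rewrite d0.
  by rewrite prodr_const card_ord.
rewrite negb_forall => /existsP[j /negbTE dj].
by rewrite (bigD1 j) //= dj mul0r.
Qed.

(** The [l]-th Fourier coefficient computed by the Riemann sum over the grid. *)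
Definition dft (f : 'cV[R]_n -> R[i]) (l : 'cV[int]_n) : R[i] :=
  (grid_size%:R ^+ n)^-1 * \sum_(t : grid) f (grid_pt t) * cis (- phase l (grid_pt t)).

Let N0 : (grid_size%:R ^+ n : R[i]) != 0.
Proof. by rewrite expf_neq0 // pnatr_eq0. Qed.

Lemma phase_grid_pt (l : 'cV[int]_n) (t : grid) :
  phase l (grid_pt t) = \sum_j grid_step * (l j 0)%:~R * (t j)%:R.
Proof. by apply: eq_bigr => j _; rewrite mxE mulrCA mulrA. Qed.

(** The same orthogonality in the dual variable, once the frequencies are
    recentred. *)
Lemma dirichlet_sum (t t0 : grid) :
  \sum_(k : grid) cis (- phase (grid_freq k) (grid_pt t) + phase (grid_freq k) (grid_pt t0))
  = if t == t0 then grid_size%:R ^+ n else 0.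
Proof.
pose d j : int := (t0 j)%:Z - (t j)%:Z.
have dN j : (`|d j| < grid_size)%N.
  by rewrite /d; have := ltn_ord (t0 j); have := ltn_ord (t j); lia.
have -> : (t == t0) = [forall j, d j == 0].
  apply/eqP/forallP => [tt0 j|h]; first by rewrite /d tt0 subrr.
  apply/ffunP => j; apply/val_inj => /=; have := h j; rewrite /d.
  by rewrite subr_eq0 => /eqP[].
rewrite -(grid_orthogonality dN).
have -> : \sum_(k : grid) cis (- phase (grid_freq k) (grid_pt t)
      + phase (grid_freq k) (grid_pt t0))
   = cis (- \sum_j grid_step * K%:R * (d j)%:~R) *
     \sum_(k : grid) cis (\sum_j grid_step * (d j)%:~R * (k j)%:R).
  rewrite big_distrr /=; apply: eq_bigr => k _; rewrite -cisD; congr cis.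
  rewrite !phase_grid_pt -!sumrN -!big_split /=; apply: eq_bigr => j _.
  by rewrite !mxE /d !rmorphB /=; ring.
rewrite grid_orthogonality //; case: ifP => [/forallP h|]; last by rewrite mulr0.
by rewrite big1 ?oppr0 ?cis0 ?mul1r // => j _; rewrite (eqP (h j)) mulr0.
Qed.

Lemma dft_inversion f (t0 : grid) :
  \sum_(k : grid) dft f (grid_freq k) * cis (phase (grid_freq k) (grid_pt t0)) =
  f (grid_pt t0).
Proof.
under eq_bigr do rewrite /dft -mulrA big_distrl.
rewrite -big_distrr /= exchange_big /=.
have -> : \sum_(t : grid) \sum_(k : grid)
      f (grid_pt t) * cis (- phase (grid_freq k) (grid_pt t))
      * cis (phase (grid_freq k) (grid_pt t0))
    = \sum_(t : grid) f (grid_pt t) * (if t == t0 then grid_size%:R ^+ n else 0).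
  apply: eq_bigr => t _; rewrite -dirichlet_sum big_distrr /=.
  by apply: eq_bigr => k _; rewrite cisD mulrA.
rewrite (bigD1 t0) //= eqxx big1 => [|t /negbTE ->]; last by rewrite mulr0.
by rewrite addr0 mulrCA mulVf // mulr1.
Qed.

Lemma dft_cis (k l : 'cV[int]_n) : (forall j, (`|(k j 0 - l j 0)%R| < grid_size)%N) ->
  dft (fun x => cis (phase k x)) l = (k == l)%:R.
Proof.
move=> kl; rewrite /dft.
have -> : \sum_(t : grid) cis (phase k (grid_pt t)) * cis (- phase l (grid_pt t)) =
   \sum_(t : grid) cis (\sum_j grid_step * (k j 0 - l j 0)%:~R * (t j)%:R).
  apply: eq_bigr => t _; rewrite -cisD !phase_grid_pt -sumrN -big_split /=.
  by congr cis; apply: eq_bigr => j _; rewrite rmorphB /=; ring.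
rewrite grid_orthogonality //.
have -> : [forall j, k j 0 - l j 0 == 0] = (k == l).
  apply/forallP/eqP => [h|-> j]; last by rewrite subrr.
  by apply/colP => j; apply/eqP; rewrite -subr_eq0.
by case: eqP; rewrite ?mulr0 ?mulVf.
Qed.

Lemma dft_lin (a : R[i]) f g l :
  dft (fun x => a * f x + g x) l = a * dft f l + dft g l.
Proof.
rewrite /dft mulrCA -mulrDr [a * _]mulr_sumr -big_split /=; congr (_ * _).
by apply: eq_bigr => t _; rewrite mulrDl mulrA.
Qed.

Lemma dft_bound f l B : (forall x, normc (f x) <= B) -> normc (dft f l) <= B.
Proof.
move=> fB; rewrite /dft normcM.
apply: (@le_trans _ _ (normc (grid_size%:R ^+ n)^-1 * (B * grid_size%:R ^+ n))).
  rewrite ler_wpM2l ?normc_ge0 // (le_trans (le_normc_sum _ _ _)) //.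
  rewrite (@le_trans _ _ (\sum_(t : grid) B)) //.
    by apply: ler_sum => t _; rewrite normcM normc_cis mulr1.
  by rewrite sumr_const card_ffun !card_ord -natrX mulr_natr.
rewrite normcV.
have -> : grid_size%:R ^+ n = (grid_size%:R ^+ n)%:C :> R[i].
  by rewrite rmorphXn /= rmorph_nat.
rewrite normc_real ger0_norm ?exprn_ge0 //.
by rewrite mulrCA mulVf ?mulr1 // expf_neq0 // grid_size_neq0.
Qed.

End Grid.

(** * Difference quotients and uniform decay *)

Section Difference.
Variables (R : realType) (n : nat).
Implicit Types (f : 'cV[R]_n -> R[i]) (j : 'I_n) (l : 'cV[int]_n).

Definition ej j : 'cV[R]_n := delta_mx j 0.

Definition tperiodic (T : zmodType) (f : 'cV[R]_n -> T) :=
  forall j : 'I_n, periodic f ((pi *+ 2) *: delta_mx j 0).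

Lemma tperiodic_mul f g : tperiodic f -> tperiodic g ->
  tperiodic (fun x => f x * g x).
Proof. by move=> hf hg j x; rewrite hf hg. Qed.

Lemma tperiodic_cis l : tperiodic (fun x : 'cV[R]_n => cis (- phase l x)).
Proof.
move=> j x; rewrite phaseD phaseZ phase_delta opprD mulrC -mulNr.
by rewrite -rmorphN cisD2piz.
Qed.

Section OnGrid.
Variable K : nat.
Local Notation grid := (grid n K).
Local Notation h := (grid_step R K).

Definition grid_shift j (t : grid) : grid :=
  [ffun i => if i == j then ordS (t i) else t i].

Lemma grid_shift_inj j : injective (grid_shift j).
Proof.
move=> t u /ffunP tu; apply/ffunP => i; have := tu i; rewrite !ffunE.
by case: ifP => // _; exact: ordS_inj.
Qed.

Lemma grid_pt_shift (T : zmodType) (g : 'cV[R]_n -> T) j (t : grid) :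
  tperiodic g -> g (grid_pt R (grid_shift j t)) = g (grid_pt R t + h *: ej j).
Proof.
move=> pg; have [tj|tj] := eqVneq (t j).+1 (grid_size K).
  have e := grid_sizeM R K; rewrite -tj -natr1 in e.
  rewrite -(pg j); congr g; apply/colP => i; rewrite !mxE ffunE.
  case: eqP => [->|_]; rewrite ?mulr1 ?mulr0 ?addr0 //=.
  by rewrite tj modnn mulr0 add0r -e; ring.
congr g; apply/colP => i; rewrite !mxE ffunE.
case: eqP => [->|_]; rewrite ?mulr1 ?mulr0 ?addr0 //=.
rewrite modn_small; first by rewrite -natr1; ring.
by rewrite ltn_neqAle tj ltn_ord.
Qed.

Lemma grid_sum_shift (V : zmodType) (g : 'cV[R]_n -> V) j : tperiodic g ->
  \sum_(t : grid) g (grid_pt R t + h *: ej j) = \sum_(t : grid) g (grid_pt R t).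
Proof.
move=> pg; rewrite [RHS](reindex_inj (@grid_shift_inj j)).
by apply: eq_bigr => t _; rewrite grid_pt_shift.
Qed.

Lemma dft_shift f j l : tperiodic f ->
  dft K (fun x => f (x + h *: ej j)) l = cis (h * (l j 0)%:~R) * dft K f l.
Proof.
move=> pf; rewrite /dft mulrCA; congr (_ * _).
rewrite -(grid_sum_shift j (tperiodic_mul pf (@tperiodic_cis l))) big_distrr /=.
apply: eq_bigr => t _; rewrite mulrCA -cisD phaseD phaseZ phase_delta.
by congr (_ * cis _); ring.
Qed.

End OnGrid.

Definition dquot h j f x : R[i] := (h^-1)%:C * (f (x + h *: ej j) - f x).

Lemma dquot_periodic h j f : tperiodic f -> tperiodic (dquot h j f).
Proof. by move=> pf i x; rewrite /dquot addrAC !pf. Qed.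

Lemma dft_dquot K f j l : tperiodic f ->
  dft K (dquot (grid_step R K) j f) l =
  ((grid_step R K)^-1)%:C * (cis (grid_step R K * (l j 0)%:~R) - 1) * dft K f l.
Proof.
move=> pf; set a : R[i] := ((grid_step R K)^-1)%:C.
have -> : dquot (grid_step R K) j f =
    (fun x => a * f (x + grid_step R K *: ej j) + ((- a) * f x + 0)).
  by apply/funext => x; rewrite /dquot addr0 mulNr -mulrBr.
rewrite dft_lin dft_shift // dft_lin.
have -> : dft K (fun=> 0 : R[i]) l = 0.
  by rewrite /dft big1 ?mulr0 // => t _; rewrite mul0r.
ring.
Qed.

Definition in_box (K : nat) l := [forall j, (`|l j 0%R| <= K)%N].

(** The finite transform turns a difference quotient of step [h] into the factor
    [(cis (h * l j) - 1) / h], and [h * l j] stays in [[-pi, pi]] for frequencies of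
    the box. *)
Lemma dft_dquot_ge K f j l : tperiodic f -> in_box K l ->
  `|(l j 0)%:~R| * normc (dft K f l) <=
  2 * normc (dft K (dquot (grid_step R K) j f) l).
Proof.
move=> pf /forallP /(_ j) lK; rewrite dft_dquot //.
move: (dft K f l) => D; rewrite 2!normcM [leRHS]mulrA.
rewrite ler_wpM2r ?normc_ge0 //; have h0 := grid_step_gt0 R K.
rewrite normc_real [`|_^-1|]ger0_norm ?invr_ge0 ?(ltW h0) //.
have := @cisB1_ge R (grid_step R K * (l j 0)%:~R).
rewrite normrM (gtr0_norm h0); set L := `|_%:~R|.
move=> H; have {}/H : grid_step R K * L <= pi.
  have LK : L <= K%:R by rewrite /L -intr_norm -[K%:R]/(K%:~R) ler_int.
  have : grid_step R K * (grid_size K)%:R = pi *+ 2 by rewrite mulrC grid_sizeM.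
  rewrite /grid_size -natr1 -mul2n natrM -mulr_natr => e.
  have : grid_step R K * L <= grid_step R K * K%:R by rewrite ler_wpM2l // ltW.
  lra.
move=> H; have -> : L = 2 * ((grid_step R K)^-1 * (grid_step R K * L / 2)).
  by field; rewrite gt_eqF.
by rewrite ler_wpM2l // ler_wpM2l ?invr_ge0 ?(ltW h0).
Qed.

Lemma iter_dquot_periodic M h j f : tperiodic f -> tperiodic (iter M (dquot h j) f).
Proof. by move=> pf; elim: M => [//|M IH] /=; exact: dquot_periodic. Qed.

Lemma dft_iter_dquot_ge M K f j l : tperiodic f -> in_box K l ->
  `|(l j 0)%:~R| ^+ M * normc (dft K f l) <=
  2 ^+ M * normc (dft K (iter M (dquot (grid_step R K) j) f) l).
Proof.
move=> pf lK; elim: M => [|M IH]; first by rewrite !expr0.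
rewrite exprS -mulrA (le_trans (ler_wpM2l _ IH)) // mulrCA exprSr -mulrA.
rewrite ler_wpM2l ?exprn_ge0 //=.
exact/dft_dquot_ge/lK/iter_dquot_periodic.
Qed.

End Difference.

Section RealDifference.
Variables (R : realType) (n : nat).
Implicit Types (f : 'cV[R]_n -> R) (j : 'I_n).

Definition rquot (h : R) j f (x : 'cV[R]_n) : R := h^-1 * (f (x + h *: ej R j) - f x).

Definition pd j f x : R := 'D_(delta_mx j 0) f x.

Lemma is_derive_along f (x v : 'cV[R]_n) (t d : R) :
  is_derive (t *: v + x) v f d -> is_derive t 1 (fun s : R => f (s *: v + x)) d.
Proof.
move=> [df Df]; split; last rewrite -Df /derive.
  move: df; rewrite /derivable; set g1 := fun h => _; set g2 := fun h => _.
  suff -> : g1 = g2 by [].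
  by apply/funext => h; rewrite /g1 /g2 /= [h *: 1]mulr1 scalerDl addrA.
set g1 := fun h => _; set g2 := fun h => _.
suff -> : g1 = g2 by [].
by apply/funext => h; rewrite /g1 /g2 /= [h *: 1]mulr1 scalerDl addrA.
Qed.

Lemma rquot_bound (h : R) j f (B : R) : 0 < h ->
  (forall x, derivable f x (delta_mx j 0)) -> (forall x, `|pd j f x| <= B) ->
  forall x : 'cV[R]_n, `|rquot h j f x| <= B.
Proof.
move=> h0 df dB x.
have dl (t : R) : is_derive t 1 (fun s : R => f (s *: ej R j + x))
    (pd j f (t *: ej R j + x)).
  by apply: is_derive_along; split.
have [|c _] := @MVT_segment R _ (fun t => pd j f (t *: ej R j + x)) 0 h (ltW h0)
    (fun t _ => dl t).
  by apply: derivable_within_continuous => t _; have [] := dl t.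
rewrite scale0r add0r subr0 [h *: _ + x]addrC /rquot => ->.
by rewrite mulrC mulfK ?gt_eqF.
Qed.

Lemma iter_pderiv_rcons w j f :
  iter_pderiv (rcons w j) f = iter_pderiv w (pd j f).
Proof. by rewrite /iter_pderiv foldr_rcons. Qed.

Lemma smooth_pd j f : smooth f -> smooth (pd j f).
Proof. by move=> sf w; rewrite -iter_pderiv_rcons; exact: sf. Qed.

Lemma smooth_derivable j f x : smooth f -> derivable f x (delta_mx j 0).
Proof. by move=> /(_ [::])[_]; exact. Qed.

Lemma is_derive_rquot h i j f x : (forall x, derivable f x (delta_mx i 0)) ->
  is_derive x (delta_mx i 0) (rquot h j f) (rquot h j (pd i f) x).
Proof.
move=> df; have d1 : is_derive x (delta_mx i 0) f (pd i f x) by split.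
have d2 : is_derive x (delta_mx i 0) (fun y => f (y + h *: ej R j))
    (pd i f (x + h *: ej R j)).
  have [d e] : is_derive (x + h *: ej R j) (delta_mx i 0) f
      (pd i f (x + h *: ej R j)) by split.
  split; last rewrite -e /derive.
    move: d; rewrite /derivable; set g1 := fun h => _; set g2 := fun h => _.
    suff -> : g1 = g2 by [].
    by apply/funext => s; rewrite /g1 /g2 /= addrA.
  set g1 := fun h => _; set g2 := fun h => _.
  suff -> : g1 = g2 by [].
  by apply/funext => s; rewrite /g1 /g2 /= addrA.
exact: (is_deriveZ h^-1 (is_deriveB d2 d1)).
Qed.

(** Difference quotients commute with derivatives, so that the mean value theorem
    can be applied once per quotient. *)
Lemma iter_rquot_bound M (h : R) j f (B : R) : 0 < h -> smooth f ->
  (forall x, `|iter_pderiv (nseq M j) f x| <= B) ->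
  forall x, `|iter M (rquot h j) f x| <= B.
Proof.
move=> h0 sf.
have aux m g : smooth g ->
    forall x, is_derive x (delta_mx j 0) (iter m (rquot h j) g)
      (iter m (rquot h j) (pd j g) x).
  move=> sg; elim: m => [|m IH] x /=.
    by split => //; exact: smooth_derivable.
  have dm y : derivable (iter m (rquot h j) g) y (delta_mx j 0) by have [] := IH y.
  have := is_derive_rquot h j x dm.
  have -> : pd j (iter m (rquot h j) g) = iter m (rquot h j) (pd j g) => //.
  by apply/funext => y; rewrite /pd; have [_ ->] := IH y.
elim: M f sf => [//|M IH] f sf fB x /=; apply: rquot_bound => // y.
  by have [] := aux M f sf y.
rewrite /pd; have [_ ->] := aux M f sf y; apply: IH; first exact: smooth_pd.
move=> z; rewrite -iter_pderiv_rcons.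
have -> : rcons (nseq M j) j = nseq M.+1 j by elim: (M) => //= m ->.
exact: fB.
Qed.

End RealDifference.

Section Decay.
Variables (R : realType) (n : nat).
Implicit Types (phi : testfun R n) (l : 'cV[int]_n).

Definition seminorm_le N phi (B : R) :=
  forall (w : seq 'I_n) x, (size w <= N)%N ->
    `|iter_pderiv w (fun y => complex.Re (phi y)) x| <= B
    /\ `|iter_pderiv w (fun y => complex.Im (phi y)) x| <= B.

Lemma iter_dquot_bound N M phi B h j x : 0 < h -> (M <= N)%N ->
  seminorm_le N phi B -> normc (iter M (dquot h j) phi x) <= 2 * B.
Proof.
move=> h0 MN sB.
have e : forall m, (fun y => complex.Re (iter m (dquot h j) phi y)) =
       iter m (rquot h j) (fun y => complex.Re (phi y)) /\
    (fun y => complex.Im (iter m (dquot h j) phi y)) =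
       iter m (rquot h j) (fun y => complex.Im (phi y)).
  elim=> [//|m [e1 e2]]; split; rewrite !iterS -?e1 -?e2; apply/funext => y /=;
    rewrite /rquot /dquot.
    by move: (iter _ _ _ _) => [a b]; move: (iter _ _ _ _) => [c d] /=;
      rewrite mul0r subr0.
  by move: (iter _ _ _ _) => [a b]; move: (iter _ _ _ _) => [c d] /=;
    rewrite mul0r addr0.
have bR : `|complex.Re (iter M (dquot h j) phi x)| <= B.
  have [/(congr1 (@^~ x)) /= -> _] := e M.
  apply: iter_rquot_bound => // [|y]; first exact: testfun_smooth_Re.
  by have [|//] := sB (nseq M j) y; rewrite size_nseq.
have bI : `|complex.Im (iter M (dquot h j) phi x)| <= B.
  have [_ /(congr1 (@^~ x)) /= ->] := e M.
  apply: iter_rquot_bound => // [|y]; first exact: testfun_smooth_Im.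
  by have [|//] := sB (nseq M j) y; rewrite size_nseq.
by rewrite (le_trans (normc_le_ReIm _)) // mulr2n mulrDl mul1r lerD.
Qed.

Lemma normc_le_seminorm N phi B x : seminorm_le N phi B -> normc (phi x) <= 2 * B.
Proof.
move=> /(_ [::] x isT)[/= h1 h2].
by rewrite (le_trans (normc_le_ReIm _)) // mulr2n mulrDl mul1r lerD.
Qed.

Definition weight l : R := 1 + enormsq (map_mx intr l : 'cV[R]_n).

Lemma enormsq_ge0 (x : 'cV[R]_n) : 0 <= enormsq x.
Proof. by apply: sumr_ge0 => i _; exact: sqr_ge0. Qed.

Lemma weight_ge1 l : 1 <= weight l.
Proof. by rewrite lerDl enormsq_ge0. Qed.

Lemma weight_gt0 l : 0 < weight l.
Proof. exact: lt_le_trans (weight_ge1 l). Qed.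

(** The sum in the weight is at most [n.+1] times its largest term, and a power of
    that term is one of the terms on the right. *)
Lemma weightXM_le M l : weight l ^+ M <=
  n.+1%:R ^+ M * (1 + \sum_(j < n) `|(l j 0)%:~R| ^+ (M.*2)).
Proof.
pose y j : R := `|(l j 0)%:~R|.
have wE : weight l = 1 + \sum_(j < n) y j ^+ 2.
  by congr (_ + _); apply: eq_bigr => j _; rewrite !mxE real_normK ?num_real.
have y0 j : 0 <= y j by exact: normr_ge0.
have s0 j : 0 <= y j ^+ M.*2 by rewrite exprn_ge0.
have w0 : 0 <= weight l := ltW (weight_gt0 l).
(* either some coordinate dominates, or all of them are at most [1] *)
have [[j0 j0P]|no] := pselect (exists j0, 1 <= y j0 ^+ 2 /\ forall j, y j ^+ 2 <= y j0 ^+ 2).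
  have [j1 jm] := j0P.
  apply: (@le_trans _ _ ((n.+1%:R * y j0 ^+ 2) ^+ M)).
    rewrite lerXn2r ?nnegrE ?mulr_ge0 ?sqr_ge0 //.
    rewrite wE -nat1r mulrDl mul1r lerD //.
    apply: le_trans (ler_sum _ (fun j _ => jm j)) _.
    by rewrite sumr_const card_ord mulr_natl.
  rewrite exprMn ler_wpM2l ?exprn_ge0 // -exprM mul2n.
  rewrite (bigD1 j0) //= addrCA lerDl addr_ge0 //.
  by apply: sumr_ge0 => j _.
have small j : y j ^+ 2 <= 1.
  rewrite leNgt; apply/negP => yj; apply: no.
  have [j0 _ j0m] := @arg_maxP _ _ _ j predT (fun j => y j ^+ 2) isT.
  exists j0; split=> [|i]; last exact: j0m.
  exact: le_trans (ltW yj) (j0m j isT).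
apply: (@le_trans _ _ (n.+1%:R ^+ M)).
  rewrite lerXn2r ?nnegrE // wE -nat1r lerD2l.
  apply: le_trans (ler_sum _ (fun j _ => small j)) _.
  by rewrite sumr_const card_ord.
by rewrite ler_peMr ?exprn_ge0 // lerDl sumr_ge0.
Qed.

Definition decay_cst M : R := n.+1%:R ^+ M * (1 + n%:R * 4 ^+ M) * 2.

Lemma decay_cst_ge0 M : 0 <= decay_cst M.
Proof. by rewrite !mulr_ge0 ?exprn_ge0 ?addr_ge0 ?mulr_ge0 ?exprn_ge0. Qed.

(** The finite transforms of a smooth function decay at a rate that does not
    depend on the grid. This is the only estimate needed on Fourier coefficients:
    it gives both the convergence of the series that defines a distribution and the
    completeness of the exponentials. *)
Lemma dft_decay M K phi B l : in_box K l -> seminorm_le M.*2 phi B ->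
  weight l ^+ M * normc (dft K phi l) <= decay_cst M * B.
Proof.
move=> lK sB; have pphi : tperiodic phi by move=> j; exact: testfun_periodic.
have hb m j : (m <= M.*2)%N -> `|(l j 0)%:~R| ^+ m * normc (dft K phi l) <= 2 ^+ m * (2 * B).
  move=> mM; apply: le_trans (dft_iter_dquot_ge m j pphi lK) _.
  rewrite ler_wpM2l ?exprn_ge0 //; apply: dft_bound => x.
  exact: (@iter_dquot_bound M.*2 _ _ _ _ _ _ (grid_step_gt0 R K)).
have h0 : normc (dft K phi l) <= 2 * B.
  by apply: dft_bound => x; exact: (normc_le_seminorm x sB).
have W := weightXM_le M l; set D := normc _ in hb h0 *.
have D0 : 0 <= D by exact: normc_ge0.
apply: le_trans (ler_wpM2r D0 W) _.
rewrite /decay_cst -!mulrA ler_wpM2l ?exprn_ge0 // mulrDl mul1r [leRHS]mulrDl.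
rewrite mul1r lerD // mulr_suml.
apply: le_trans (ler_sum _ (fun j _ => hb _ j (leqnn _))) _.
rewrite sumr_const card_ord -[leLHS]mulr_natl -mul2n exprM -!mulrA.
by rewrite expr2 -natrM.
Qed.

End Decay.

(** * Sums over boxes of frequencies *)

Section Box.
Variables (R : realType) (n : nat).
Implicit Types (l : 'cV[int]_n) (K : nat).

Definition box K : seq 'cV[int]_n := [seq grid_freq k | k : grid n K].

Lemma grid_freq_inj K : injective (@grid_freq n K).
Proof.
move=> k k' /colP kk; apply/ffunP => j; apply/val_inj => /=.
by have := kk j; rewrite !mxE => /addIr[].
Qed.

Lemma box_uniq K : uniq (box K).
Proof. by rewrite map_inj_uniq ?enum_uniq //; exact: grid_freq_inj. Qed.

Lemma mem_box K l : (l \in box K) = in_box K l.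
Proof.
rewrite /box /in_box; apply/mapP/forallP => [[k _ ->] j|lK].
  rewrite mxE; move: (k j) => [m /= hm]; rewrite /grid_size in hm; lia.
have lt j : (`|(l j 0%R + K%:Z)%R| < grid_size K)%N.
  by have := lK j; rewrite /grid_size; lia.
exists [ffun j => Ordinal (lt j)]; rewrite ?mem_enum //; apply/colP => j; rewrite mxE ffunE /=.
by have := lK j; lia.
Qed.

Lemma big_box (V : zmodType) K (F : 'cV[int]_n -> V) :
  \sum_(l <- box K) F l = \sum_(k : grid n K) F (grid_freq k).
Proof. by rewrite big_map big_enum. Qed.

Lemma in_boxS K K' l : (K <= K')%N -> in_box K l -> in_box K' l.
Proof.
move=> KK /forallP lK; apply/forallP => j; exact: leq_trans (lK j) KK.
Qed.

Lemma big_box_restrict (V : zmodType) K K' (F : 'cV[int]_n -> V) : (K <= K')%N ->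
  \sum_(l <- box K' | in_box K l) F l = \sum_(l <- box K) F l.
Proof.
move=> KK; rewrite -big_filter; apply: perm_big; apply: uniq_perm.
- by rewrite filter_uniq ?box_uniq.
- exact: box_uniq.
move=> l; rewrite mem_filter !mem_box; case lK: (in_box K l) => //=.
exact: in_boxS lK.
Qed.

(** From [K] to [K.+1] the right-hand side grows by [4 / k - 4 / (k + 1)] with
    [k = K.+1], which is [4 / (k * (k + 1))]; the two new terms [(1 + k ^+ 2)^-1] are
    at most half of that each. *)
Lemma inv_sq_sum K :
  \sum_(m < grid_size K) (1 + (m%:R - K%:R) ^+ 2)^-1 <= 5 - 4 / K.+1%:R :> R.
Proof.
elim: K => [|K IH].
  rewrite /grid_size big_ord_recl big_ord0 subrr expr0n /= !addr0 invr1; lra.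
rewrite /grid_size doubleS big_ord_recl big_ord_recr /=.
have -> : \sum_(i < K.*2.+1) (1 + ((bump 0 i)%:R - K.+1%:R) ^+ 2)^-1 =
   \sum_(m < grid_size K) (1 + (m%:R - K%:R) ^+ 2)^-1 :> R.
  apply: eq_bigr => i _; rewrite /bump leq0n /= add1n -!natr1.
  by congr (_ + _ ^+ 2)^-1; ring.
have -> : 1 + (0 - K.+1%:R) ^+ 2 = 1 + K.+1%:R ^+ 2 :> R by ring.
have -> : 1 + ((bump 0 K.*2.+1)%:R - K.+1%:R) ^+ 2 = 1 + K.+1%:R ^+ 2 :> R.
  rewrite /bump leq0n /= add1n -mul2n -!natr1 natrM; ring.
have k0 : 0 < K.+1%:R :> R by rewrite ltr0n.
rewrite -[K.+2%:R]natr1; move: IH k0; move: (K.+1%:R : R) (\sum_(_ < _) _) => k S IH k0.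
have h : (1 + k ^+ 2)^-1 <= 2 / (k * (k + 1)).
  rewrite ler_pdivlMr ?mulr_gt0 ?addr_gt0 // mulrC ler_pdivrMr.
    by have := sqr_ge0 (k - 1); nra.
  by rewrite (lt_le_trans ltr01) // lerDl sqr_ge0.
have e : 4 / k - 4 / (k + 1) = 2 * (2 / (k * (k + 1))).
  have k1 : k + 1 != 0 by rewrite gt_eqF // addr_gt0.
  have kn : k != 0 by rewrite gt_eqF.
  by field; rewrite k1 kn.
lra.
Qed.

(** The weight dominates each [1 + l_j ^+ 2], and the sum of the product of the
    inverses factors. *)
Lemma weight_sum K : \sum_(l <- box K) (weight R l)^-1 ^+ n <= 5 ^+ n.
Proof.
rewrite big_box.
have lw (k : grid n K) : (weight R (grid_freq k))^-1 ^+ n <=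
    \prod_(j < n) (1 + ((k j)%:R - K%:R) ^+ 2)^-1.
  rewrite -[X in _ ^+ X]card_ord -prodr_const; apply: ler_prod => j _.
  rewrite invr_ge0 (ltW (weight_gt0 _ _)) /= lef_pV2 ?posrE ?weight_gt0 //.
    rewrite /weight /enormsq lerD2l (bigD1 j) //= !mxE rmorphB /= lerDl.
    by apply: sumr_ge0 => i _; exact: sqr_ge0.
  by rewrite (lt_le_trans ltr01) // lerDl sqr_ge0.
apply: le_trans (ler_sum _ (fun k _ => lw k)) _.
rewrite -(bigA_distr_bigA (fun j (m : 'I_(grid_size K)) => (1 + (m%:R - K%:R) ^+ 2)^-1)) /=.
rewrite -[X in _ <= _ ^+ X]card_ord -prodr_const; apply: ler_prod => j _.
apply/andP; split.
  by apply: sumr_ge0 => m _; rewrite invr_ge0 addr_ge0 // sqr_ge0.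
by rewrite (le_trans (inv_sq_sum K)) // gerBl divr_ge0.
Qed.

End Box.

(** * Operations on test functions *)

Section TestFunctions.
Variables (R : realType) (n : nat).
Implicit Types (phi psi : testfun R n) (l : 'cV[int]_n).

Lemma iter_pderiv_lin w (p q : R) (f g : 'cV[R]_n -> R) : smooth f -> smooth g ->
  iter_pderiv w (fun x => p * f x + q * g x) =
  (fun x => p * iter_pderiv w f x + q * iter_pderiv w g x).
Proof.
move=> sf sg; elim: w => [//|j w IH] /=; rewrite IH; apply/funext => x.
have [_ /(_ j x) df] := sf w; have [_ /(_ j x) dg] := sg w.
have d1 : is_derive x (delta_mx j 0) (iter_pderiv w f)
   ('D_(delta_mx j 0) (iter_pderiv w f) x) by split.
have d2 : is_derive x (delta_mx j 0) (iter_pderiv w g)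
   ('D_(delta_mx j 0) (iter_pderiv w g) x) by split.
by have [_ ->] := is_deriveD (is_deriveZ p d1) (is_deriveZ q d2).
Qed.

Lemma smooth_lin (p q : R) (f g : 'cV[R]_n -> R) : smooth f -> smooth g ->
  smooth (fun x => p * f x + q * g x).
Proof.
move=> sf sg w; rewrite iter_pderiv_lin //.
have [cf df] := sf w; have [cg dg] := sg w; split=> [x|j x].
  exact: (cvgD (cvgM (cvg_cst _) (cf x)) (cvgM (cvg_cst _) (cg x))).
have d1 : is_derive x (delta_mx j 0) (iter_pderiv w f)
   ('D_(delta_mx j 0) (iter_pderiv w f) x) by split; first exact: df.
have d2 : is_derive x (delta_mx j 0) (iter_pderiv w g)
   ('D_(delta_mx j 0) (iter_pderiv w g) x) by split; first exact: dg.
by have [] := is_deriveD (is_deriveZ p d1) (is_deriveZ q d2).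
Qed.

Definition lin_fun (a : R[i]) phi psi (x : 'cV[R]_n) : R[i] := a * phi x + psi x.

Lemma lin_fun_Re a phi psi : (fun x => complex.Re (lin_fun a phi psi x)) =
  (fun x => 1 * (complex.Re a * complex.Re (phi x) + (- complex.Im a) * complex.Im (phi x))
            + 1 * complex.Re (psi x)).
Proof.
apply/funext => x; rewrite /lin_fun; case: a => a b; case: (phi x) => c d.
by case: (psi x) => e f /=; rewrite !mul1r mulNr.
Qed.

Lemma lin_fun_Im a phi psi : (fun x => complex.Im (lin_fun a phi psi x)) =
  (fun x => 1 * (complex.Re a * complex.Im (phi x) + complex.Im a * complex.Re (phi x))
            + 1 * complex.Im (psi x)).
Proof.
apply/funext => x; rewrite /lin_fun; case: a => a b; case: (phi x) => c d.
by case: (psi x) => e f /=; rewrite !mul1r.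
Qed.

Lemma lin_fun_periodic a phi psi : tperiodic (lin_fun a phi psi).
Proof. by move=> j x; rewrite /lin_fun !testfun_periodic. Qed.

Lemma lin_fun_smooth_Re a phi psi : smooth (fun x => complex.Re (lin_fun a phi psi x)).
Proof.
rewrite lin_fun_Re; apply: smooth_lin; last exact: testfun_smooth_Re.
by apply: smooth_lin; [exact: testfun_smooth_Re|exact: testfun_smooth_Im].
Qed.

Lemma lin_fun_smooth_Im a phi psi : smooth (fun x => complex.Im (lin_fun a phi psi x)).
Proof.
rewrite lin_fun_Im; apply: smooth_lin; last exact: testfun_smooth_Im.
by apply: smooth_lin; [exact: testfun_smooth_Im|exact: testfun_smooth_Re].
Qed.

(** Test functions form a complex vector space stable under derivatives. It is
    handled through [tlin], the shape of the linearity axiom of [pvdist]. *)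
Definition tlin a phi psi : testfun R n :=
  TestFun (@lin_fun_periodic a phi psi) (@lin_fun_smooth_Re a phi psi)
    (@lin_fun_smooth_Im a phi psi).

Lemma pd_periodic (f : 'cV[R]_n -> R) j : tperiodic f -> tperiodic (pd j f).
Proof.
move=> pf i x; rewrite /pd /derive; set p := _ *: _.
set g1 := fun h => _; set g2 := fun h => _.
suff -> : g1 = g2 by [].
by apply/funext => h; rewrite /g1 /g2 /= addrA !pf.
Qed.

Definition tpd_fun j phi (x : 'cV[R]_n) : R[i] :=
  pd j (fun y => complex.Re (phi y)) x +i* pd j (fun y => complex.Im (phi y)) x.

Lemma tpd_periodic j phi : tperiodic (tpd_fun j phi).
Proof.
move=> i x; rewrite /tpd_fun; congr (_ +i* _).
  by apply: (@pd_periodic (fun y => complex.Re (phi y))) => k y;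
    rewrite testfun_periodic.
by apply: (@pd_periodic (fun y => complex.Im (phi y))) => k y;
    rewrite testfun_periodic.
Qed.

Definition tpd j phi : testfun R n :=
  TestFun (@tpd_periodic j phi) (smooth_pd j (testfun_smooth_Re phi))
    (smooth_pd j (testfun_smooth_Im phi)).

Definition tpds w phi : testfun R n := foldr tpd phi w.

Lemma Re_tpds w phi :
  (fun x => complex.Re (tpds w phi x)) = iter_pderiv w (fun x => complex.Re (phi x)).
Proof. by elim: w => [//|j w IH] /=; rewrite -IH. Qed.

Lemma Im_tpds w phi :
  (fun x => complex.Im (tpds w phi x)) = iter_pderiv w (fun x => complex.Im (phi x)).
Proof. by elim: w => [//|j w IH] /=; rewrite -IH. Qed.

Lemma tpd_lin j a phi psi x :
  tpd j (tlin a phi psi) x = a * tpd j phi x + tpd j psi x.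
Proof.
rewrite /= /tpd_fun.
have sR (t : testfun R n) := testfun_smooth_Re t.
have sI (t : testfun R n) := testfun_smooth_Im t.
have e1 := iter_pderiv_lin [:: j].
rewrite /pd lin_fun_Re lin_fun_Im.
have := e1 1 1 _ _ (smooth_lin (complex.Re a) (- complex.Im a) (sR phi) (sI phi)) (sR psi).
move=> /(congr1 (@^~ x)) /= ->.
have := e1 (complex.Re a) (- complex.Im a) _ _ (sR phi) (sI phi).
move=> /(congr1 (@^~ x)) /= ->.
have := e1 1 1 _ _ (smooth_lin (complex.Re a) (complex.Im a) (sI phi) (sR phi)) (sI psi).
move=> /(congr1 (@^~ x)) /= ->.
have := e1 (complex.Re a) (complex.Im a) _ _ (sI phi) (sR phi).
move=> /(congr1 (@^~ x)) /= ->.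
by rewrite !mul1r; case: (a) => p q /=; simpc.
Qed.

Lemma eq_tpd j phi psi : phi =1 psi -> tpd j phi =1 tpd j psi.
Proof.
move=> /funext e x; rewrite /= /tpd_fun.
by rewrite (_ : testfun_fun phi = testfun_fun psi).
Qed.

Definition ifreq (j : 'I_n) l : R[i] := 0 +i* (l j 0)%:~R.

Lemma tpd_expik j l x : tpd j (expik R l) x = ifreq j l * expik R l x.
Proof.
rewrite /= /tpd_fun /expik_fun /ifreq /=; simpc.
have d1 := is_derive_trig l 1 0 j x; have d2 := is_derive_trig l 0 1 j x.
have -> : (fun y : 'cV[R]_n => cos (phase l y)) = trig l 1 0.
  by apply/funext => y; rewrite /trig mul1r mul0r addr0.
have -> : (fun y : 'cV[R]_n => sin (phase l y)) = trig l 0 1.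
  by apply/funext => y; rewrite /trig mul1r mul0r add0r.
rewrite /pd; have [_ ->] := d1; have [_ ->] := d2; rewrite /trig.
by congr (_ +i* _); ring.
Qed.

Lemma seminorm_tpds N w phi B :
  seminorm_le (N + size w) phi B -> seminorm_le N (tpds w phi) B.
Proof.
move=> sB v x vN; rewrite Re_tpds Im_tpds /iter_pderiv -!foldr_cat.
by apply: sB; rewrite size_cat leq_add2r.
Qed.

Lemma tperiodic_int (T : zmodType) (f : 'cV[R]_n -> T) (m : 'cV[int]_n) x :
  tperiodic f -> f (x + \sum_j (m j 0)%:~R *: ((pi *+ 2) *: delta_mx j 0)) = f x.
Proof.
move=> pf; elim/big_ind: _ x => [x|u v hu hv x|j _ x]; first by rewrite addr0.
  by rewrite addrA hv hu.
(* negative multiples are reduced to natural ones by translating back *)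
have pn k y : f (y + k%:R *: ((pi *+ 2) *: delta_mx j 0)) = f y.
  by rewrite scaler_nat (periodicn (pf j)).
case: (m j 0) => k; first exact: pn.
rewrite NegzE rmorphN scaleNr -[in RHS](subrK (k.+1%:R *: ((pi *+ 2) *: delta_mx j 0)) x).
by rewrite pn.
Qed.

Definition cell : set 'cV[R]_n := [set x | forall j, 0 <= x j 0 < pi *+ 2].

Lemma cell_reduce (T : zmodType) (f : 'cV[R]_n -> T) x : tperiodic f ->
  exists2 y, cell y & f x = f y.
Proof.
move=> pf; have p0 : 0 < pi *+ 2 :> R by rewrite -mulr_natr mulr_gt0 ?pi_gt0.
(* translate each coordinate by its integer number of periods *)
pose m : 'cV[int]_n := \col_j (- Num.floor (x j 0 / (pi *+ 2))).
exists (x + \sum_j (m j 0)%:~R *: ((pi *+ 2) *: delta_mx j 0)); last first.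
  by rewrite tperiodic_int.
move=> j; have /andP[h1 h2] := floor_itv (x j 0 / (pi *+ 2)).
rewrite mxE summxE (bigD1 j) //= big1 => [|i /negbTE ij]; last first.
  by rewrite !mxE eq_sym ij !mulr0.
rewrite !mxE !eqxx mulr1 addr0 rmorphN mulNr subr_ge0 ltrBlDr.
rewrite -ler_pdivlMr // h1 /= -[X in X + _]mul1r -mulrDl -ltr_pdivrMr //.
by rewrite addrC -[1]/(1%:~R) -rmorphD.
Qed.

(** The closed cell is a product of segments, compact by Tychonoff's theorem; it is
    indexed as a set of rows, hence the transposition. *)
Lemma cell_bounded (f : 'cV[R]_n -> R) : continuous f ->
  exists B, forall y, cell y -> `|f y| <= B.
Proof.
move=> cf; pose A : set 'rV[R]_n := [set v | forall i, `[0, pi *+ 2]%classic (v ord0 i)].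
have cA : compact A.
  exact: (@rV_compact R n (fun=> `[0, pi *+ 2]%classic) (fun=> @segment_compact R 0 _)).
have ctr : continuous (fun v : 'rV[R]_n => v^T : 'cV[R]_n).
  move=> v U [P hP PU]; exists (fun i j => P j i) => [i j|u hu].
    by have := hP j i; rewrite mxE.
  by apply: PU => i j; rewrite mxE; exact: hu.
have cg : {within A, continuous (fun v : 'rV[R]_n => `|f v^T|)}.
  apply: continuous_subspaceT => v.
  apply: continuous_comp; last exact: norm_continuous.
  by apply: continuous_comp; [exact: ctr|exact: cf].
have p0 : 0 <= pi *+ 2 :> R by rewrite mulrn_wge0 // pi_ge0.
have A0 : A !=set0.
  by exists 0 => i /=; rewrite mxE in_itv /= lexx.
have [c _ cm] := EVT_max_rV A0 cA cg.
exists `|f c^T| => y yc; have := cm y^T; rewrite trmxK; apply.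
rewrite inE => i /=; rewrite mxE in_itv /=.
by have /andP[-> /ltW ->] := yc i.
Qed.

Lemma testfun_bounded phi : exists B, forall x,
  `|complex.Re (phi x)| <= B /\ `|complex.Im (phi x)| <= B.
Proof.
have [B1 h1] := @cell_bounded (fun x => complex.Re (phi x)) (testfun_smooth_Re phi [::]).1.
have [B2 h2] := @cell_bounded (fun x => complex.Im (phi x)) (testfun_smooth_Im phi [::]).1.
exists (Num.max B1 B2) => x; have [y yc ->] := cell_reduce x (@testfun_periodic _ _ phi).
by rewrite !le_max h1 // h2 // orbT.
Qed.

(** Each derivative is a test function again, hence bounded; the last letter of the
    word of derivatives is the one applied first, so it is peeled off. *)
Lemma seminorm_exists N phi : exists2 B, 0 <= B & seminorm_le N phi B.
Proof.
elim: N phi => [|N IH] phi; have [B0 h0] := testfun_bounded phi.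
  have B00 : 0 <= B0 by have [h _] := h0 0; exact: le_trans h.
  exists B0 => // w x; rewrite leqn0 size_eq0 => /eqP -> /=; exact: h0.
have B00 : 0 <= B0 by have [h _] := h0 0; exact: le_trans h.
have /choice[B hB] : forall j, exists B, 0 <= B /\ seminorm_le N (tpd j phi) B.
  by move=> j; have [B ? ?] := IH (tpd j phi); exists B.
have s0 : 0 <= \sum_j B j by apply: sumr_ge0 => j _; have [] := hB j.
exists (B0 + \sum_j B j); first by rewrite addr_ge0.
move=> w; case/lastP: w => [|w j] x.
  have hB0 : B0 <= B0 + \sum_j B j by rewrite lerDl.
  by move=> _ /=; have [a b] := h0 x; split; apply: le_trans hB0.
rewrite size_rcons ltnS => wN; rewrite !iter_pderiv_rcons.
have [_ /(_ w x wN)[h1 h2]] := hB j.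
have h : B j <= B0 + \sum_i B i.
  rewrite (bigD1 j) //= addrCA lerDl addr_ge0 // sumr_ge0 // => i _.
  by have [] := hB i.
by split; apply: le_trans h.
Qed.

End TestFunctions.

(** * Limits along an ultrafilter *)

Section UltraLimit.

Lemma ex_ultra : exists U : set_system nat, UltraFilter U /\ \oo `<=` U.
Proof. exact: ultraFilterLemma. Qed.

(** Limits along a fixed nonprincipal ultrafilter exist for every bounded sequence
    and are linear. This makes Fourier coefficients and Fourier series total
    operations, with no convergence proof. *)
Definition oultra : set_system nat := sval (cid ex_ultra).

Lemma oultra_ultra : UltraFilter oultra.
Proof. by rewrite /oultra; case: cid => U []. Qed.

Global Instance oultra_proper : ProperFilter oultra.
Proof. exact/ultra_proper/oultra_ultra. Qed.

Lemma oultra_oo : \oo `<=` oultra.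
Proof. by rewrite /oultra; case: cid => U []. Qed.

Lemma oultra_ge (K0 : nat) : \forall K \near oultra, (K0 <= K)%N.
Proof. by apply: oultra_oo; exists K0. Qed.

Variable R : realType.
Implicit Types (u v : nat -> R[i]) (l m : R[i]).

(** A cluster point of the sequence exists by compactness, and an ultrafilter
    converges to its cluster points. *)
Lemma bounded_ultra_cvg (u : nat -> R) B : (forall K, `|u K| <= B) ->
  cvg (u @ oultra).
Proof.
move=> uB; have cB := @segment_compact R (- B) B.
have [|p [_ cp]] := cB (u @ oultra) _.
  by apply: (@filterE _ oultra) => K /=; move: (uB K); rewrite ler_norml in_itv.
apply/cvg_ex; exists p => V Vp.
(* otherwise the complement of [V] would be large and miss [V] *)
have [//|uV] := in_ultra_setVsetC (u @^-1` V) oultra_ultra.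
have [x [/= nVx Vx]] := cp (~` V) V uV Vp.
by [].
Qed.

Definition ucvg u l : Prop :=
  (fun K => complex.Re (u K)) @ oultra --> complex.Re l /\
  (fun K => complex.Im (u K)) @ oultra --> complex.Im l.

Definition ulim u : R[i] :=
  lim ((fun K => complex.Re (u K)) @ oultra) +i*
  lim ((fun K => complex.Im (u K)) @ oultra).

Lemma ulim_bounded u B : (forall K, normc (u K) <= B) -> ucvg u (ulim u).
Proof.
move=> uB; split; apply: (@bounded_ultra_cvg _ B) => K.
  exact: le_trans (Re_le_normc _) _.
exact: le_trans (Im_le_normc _) _.
Qed.

Lemma ucvg_unique u l m : ucvg u l -> ucvg u m -> l = m.
Proof.
move=> [a b] [c d]; apply/eqP; rewrite eq_complex.
by rewrite (cvg_unique _ a c) // (cvg_unique _ b d) // !eqxx.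
Qed.

Lemma ucvg_near u l : (\forall K \near oultra, u K = l) -> ucvg u l.
Proof.
by move=> ul; split; apply: cvg_near_cst; apply: filterS ul => K ->.
Qed.

Lemma ucvg_cst l : ucvg (fun=> l) l.
Proof. by apply: ucvg_near; apply: filterE. Qed.

Lemma ReD l m : complex.Re (l + m) = complex.Re l + complex.Re m.
Proof. by case: l m => ? ? [? ?]. Qed.

Lemma ImD l m : complex.Im (l + m) = complex.Im l + complex.Im m.
Proof. by case: l m => ? ? [? ?]. Qed.

Lemma ReM l m : complex.Re (l * m) =
  complex.Re l * complex.Re m - complex.Im l * complex.Im m.
Proof. by case: l m => ? ? [? ?]. Qed.

Lemma ImM l m : complex.Im (l * m) =
  complex.Re l * complex.Im m + complex.Im l * complex.Re m.
Proof. by case: l m => ? ? [? ?]. Qed.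

Lemma ucvgD u v l m : ucvg u l -> ucvg v m -> ucvg (fun K => u K + v K) (l + m).
Proof.
move=> [a b] [c d]; rewrite /ucvg ReD ImD; split.
  by under eq_fun do rewrite ReD; exact: cvgD.
by under eq_fun do rewrite ImD; exact: cvgD.
Qed.

Lemma ucvgM u v l m : ucvg u l -> ucvg v m -> ucvg (fun K => u K * v K) (l * m).
Proof.
move=> [a b] [c d]; rewrite /ucvg ReM ImM; split.
  by under eq_fun do rewrite ReM; apply: cvgB; exact: cvgM.
by under eq_fun do rewrite ImM; apply: cvgD; exact: cvgM.
Qed.

Lemma ucvg_sum (I : Type) (r : seq I) (F : I -> nat -> R[i]) (L : I -> R[i]) :
  (forall i, ucvg (F i) (L i)) ->
  ucvg (fun K => \sum_(i <- r) F i K) (\sum_(i <- r) L i).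
Proof.
move=> FL; elim: r => [|i r IH].
  by rewrite big_nil; apply: ucvg_near; apply: filterE => K; rewrite big_nil.
rewrite big_cons; under [X in ucvg X]funext do rewrite big_cons.
exact: ucvgD.
Qed.

Lemma ucvg_norm_le u l B : (\forall K \near oultra, normc (u K) <= B) ->
  ucvg u l -> normc l <= 2 * B.
Proof.
move=> uB [ure uim]; apply: le_trans (normc_le_ReIm _) _.
rewrite mulr2n mulrDl mul1r; apply: lerD.
  apply: (cvgr_to_le (cvg_norm ure)); apply: filterS uB => K.
  exact: le_trans (Re_le_normc _).
apply: (cvgr_to_le (cvg_norm uim)); apply: filterS uB => K.
exact: le_trans (Im_le_normc _).
Qed.

End UltraLimit.

(** * Distributions with prescribed Fourier coefficients *)

Section Existence.
Variables (R : realType) (n : nat).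

Lemma weightN (l : 'cV[int]_n) : weight R (- l) = weight R l.
Proof. by congr (_ + _); apply: eq_bigr => j _; rewrite !mxE rmorphN sqrrN. Qed.

Lemma in_boxN K (l : 'cV[int]_n) : in_box K (- l) = in_box K l.
Proof. by apply: eq_forallb => j; rewrite mxE abszN. Qed.

Lemma box_exists (l : 'cV[int]_n) : exists K, in_box K l.
Proof.
exists (\sum_j `|l j 0%R|)%N; apply/forallP => j.
by rewrite (bigD1 j) //= leq_addr.
Qed.

(** A summation against coefficients of polynomial growth costs [n] more powers
    of the weight, by [weight_sum]. *)
Lemma box_sum_le K M (a b : 'cV[int]_n -> R[i]) (A D : R) : 0 <= A ->
  (forall l, normc (a l) <= A * weight R l ^+ M) ->
  (forall l, in_box K l -> weight R l ^+ (M + n) * normc (b l) <= D) ->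
  normc (\sum_(l <- box n K) a l * b l) <= A * D * 5 ^+ n.
Proof.
move=> A0 ha hb; apply: le_trans (le_normc_sum _ _ _) _.
have D0 : 0 <= D.
  have h0 : in_box K (0 : 'cV[int]_n) by apply/forallP => j; rewrite mxE.
  apply: le_trans (hb _ h0); rewrite mulr_ge0 ?normc_ge0 // exprn_ge0 //.
  exact/ltW/weight_gt0.
apply: (@le_trans _ _ (\sum_(l <- box n K) A * D * (weight R l)^-1 ^+ n)); last first.
  by rewrite -mulr_sumr ler_wpM2l ?mulr_ge0 ?weight_sum.
rewrite [leLHS]big_seq [leRHS]big_seq; apply: ler_sum => l; rewrite mem_box => lK.
have w0 := weight_gt0 R l; have wM := exprn_gt0 M w0; have wn := exprn_gt0 n w0.
rewrite normcM; apply: le_trans (ler_wpM2r (normc_ge0 _) (ha l)) _.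
rewrite -!mulrA ler_wpM2l // exprVn ler_pdivlMr // mulrAC -exprD.
exact: hb.
Qed.

Variables (v : 'cV[int]_n -> 'cV[R[i]]_n) (A : R) (P : nat).
Hypothesis A0 : 0 <= A.
Hypothesis vA : forall k j, normc (v k j 0) <= A * weight R k ^+ P.

Let vol : R[i] := ((pi *+ 2) ^+ n)%:C.

Let coef_sum (phi : testfun R n) (j : 'I_n) (K : nat) : R[i] :=
  vol * \sum_(l <- box n K) v l j 0 * dft K phi (- l).

Let coef_sum_le phi j K B : seminorm_le (P + n).*2 phi B ->
  normc (coef_sum phi j K) <= normc vol * (A * decay_cst R n (P + n) * 5 ^+ n) * B.
Proof.
move=> sB; rewrite normcM -mulrA ler_wpM2l ?normc_ge0 //.
rewrite [leRHS](_ : _ = A * (decay_cst R n (P + n) * B) * 5 ^+ n); last by ring.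
apply: (@box_sum_le _ P) => // l lK.
by rewrite -weightN; apply: dft_decay => //; rewrite in_boxN.
Qed.

Let dist_fun (phi : testfun R n) : 'cV[R[i]]_n := \col_j ulim (coef_sum phi j).

Let dist_cvg phi j : ucvg (coef_sum phi j) (dist_fun phi j 0).
Proof.
rewrite mxE; have [B _ sB] := seminorm_exists (P + n).*2 phi.
by apply: ulim_bounded => K; exact: coef_sum_le sB.
Qed.

Let dist_linear (a : R[i]) (phi psi chi : testfun R n) :
  (forall x, chi x = a * phi x + psi x) ->
  dist_fun chi = a *: dist_fun phi + dist_fun psi.
Proof.
move=> e; apply/colP => j; rewrite [RHS]mxE [X in _ = X + _]mxE.
apply: ucvg_unique (dist_cvg chi j) _.
have -> : coef_sum chi j = (fun K => a * coef_sum phi j K + coef_sum psi j K).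
  apply/funext => K; rewrite /coef_sum mulrCA -mulrDr; congr (_ * _).
  rewrite mulr_sumr -big_split /=; apply: eq_bigr => l _.
  rewrite (_ : testfun_fun chi = (fun x => a * phi x + psi x)); last exact/funext.
  by rewrite dft_lin mulrDr mulrCA.
apply: ucvgD; last exact: dist_cvg.
by apply: ucvgM; [exact: ucvg_cst|exact: dist_cvg].
Qed.

Let dist_continuous : exists (N : nat) (C : R),
  forall (phi : testfun R n) (B : R), seminorm_le N phi B ->
  forall j : 'I_n, normc (dist_fun phi j 0) <= C * B.
Proof.
exists (P + n).*2, (2 * (normc vol * (A * decay_cst R n (P + n) * 5 ^+ n))).
move=> phi B sB j; rewrite -[leRHS]mulrA; apply: (ucvg_norm_le _ (dist_cvg phi j)).
by apply: filterE => K; exact: coef_sum_le.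
Qed.

(** The distribution is the ultralimit of the sums over boxes of the coefficients
    against finite transforms. On an exponential the sequence is eventually
    constant, because finite transforms of exponentials are exact. *)
Lemma pvdist_of_coef : exists u : pvdist R n, forall k, fcoef u k = v k.
Proof.
exists (PVDist dist_linear dist_continuous) => k.
rewrite /fcoef; apply/colP => j; rewrite [LHS]mxE.
have vol0 : (pi *+ 2) ^+ n != 0 :> R.
  by rewrite expf_neq0 // mulrn_eq0 /= gt_eqF ?pi_gt0.
suff -> : dist_fun (expik R (- k)) j 0 = vol * v k j 0.
  by rewrite mulrA -rmorphM /= mulVf // mul1r.
apply: ucvg_unique (dist_cvg _ j) _.
have [K0 kK0] := box_exists k.
apply: ucvg_near; apply: filterS (oultra_ge K0) => K KK.
have kK := in_boxS KK kK0.
rewrite /coef_sum; congr (_ * _).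
rewrite (bigD1_seq k) ?mem_box ?box_uniq //= [X in _ + X]big_seq_cond big1.
  rewrite addr0 -[expik_fun (- k)]/(fun x => cis (phase (- k) x)).
  rewrite dft_cis ?eqxx ?mulr1 // => i; rewrite subrr.
  by rewrite absz0.
move=> l; rewrite mem_box => /andP[lK lk].
rewrite -[expik_fun (- k)]/(fun x => cis (phase (- k) x)).
rewrite dft_cis => [|i]; first by rewrite eqr_opp eq_sym (negbTE lk) mulr0.
have /forallP/(_ i) := kK; have /forallP/(_ i) := lK.
rewrite !mxE /grid_size; move: (l i 0) (k i 0) => p q; lia.
Qed.

End Existence.

(** * Fourier series of test functions *)

Section QuotientError.
Variables (R : realType) (n : nat).
Implicit Types (f : 'cV[R]_n -> R) (j : 'I_n) (phi : testfun R n).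

(** The quotient is the derivative at some point at distance at most [h], and the
    second derivative bounds the change of the first one up to that point. *)
Lemma rquot_error (h : R) j f (B : R) x : 0 < h -> smooth f ->
  (forall y, `|pd j (pd j f) y| <= B) -> `|rquot h j f x - pd j f x| <= h * B.
Proof.
move=> h0 sf fB.
have line g (t : R) : smooth g -> is_derive t 1 (fun s : R => g (s *: ej R j + x))
    (pd j g (t *: ej R j + x)).
  by move=> sg; apply: is_derive_along; split => //; exact: smooth_derivable.
have mvt g (t : R) : smooth g -> 0 <= t -> exists2 c, 0 <= c <= t &
    g (t *: ej R j + x) - g x = pd j g (c *: ej R j + x) * t.
  move=> sg t0.
  have [|c] := @MVT_segment R _ (fun s => pd j g (s *: ej R j + x)) 0 t t0
    (fun s _ => line g s sg).
    by apply: derivable_within_continuous => s _; have [] := line g s sg.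
  by rewrite in_itv /= scale0r add0r subr0 => ct e; exists c.
have [c /andP[c0 ch] e1] := mvt f h sf (ltW h0).
have [d _ e2] := mvt (pd j f) c (smooth_pd j sf) c0.
have -> : rquot h j f x = pd j f (c *: ej R j + x).
  by rewrite /rquot [x + _]addrC e1 mulrC mulfK // gt_eqF.
rewrite e2 normrM mulrC (ger0_norm c0).
by rewrite ler_pM.
Qed.

Lemma dquot_error (h : R) j phi (B : R) x : 0 < h -> seminorm_le 2 phi B ->
  normc (tpd j phi x - dquot h j phi x) <= h * (2 * B).
Proof.
move=> h0 sB; apply: le_trans (normc_le_ReIm _) _.
have hR := @rquot_error h j _ B x h0 (testfun_smooth_Re phi)
  (fun y => (sB [:: j; j] y isT).1).
have hI := @rquot_error h j _ B x h0 (testfun_smooth_Im phi)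
  (fun y => (sB [:: j; j] y isT).2).
have -> : h * (2 * B) = h * B + h * B by ring.
apply: lerD; [move: hR|move: hI]; rewrite distrC; apply: le_trans;
  rewrite le_eqVlt; apply/orP; left; apply/eqP; congr `|_|;
  rewrite /rquot /dquot /=; case: (phi _) => a b; case: (phi _) => c d /=; ring.
Qed.

Lemma grid_step_cvg0 : grid_step R @ \oo --> 0.
Proof.
have e K : grid_step R K <= (pi *+ 2) * harmonic K.
  have p0 : 0 <= pi *+ 2 :> R by rewrite mulrn_wge0 // pi_ge0.
  rewrite /grid_step /harmonic /= ler_wpM2l //.
  by rewrite lef_pV2 ?posrE ?ltr0n // ler_nat /grid_size -addnn ltnS leq_addr.
apply: (squeeze_cvgr (f := fun=> 0) (h := fun K => (pi *+ 2) * harmonic K)).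
- by apply: filterE => K; rewrite (ltW (grid_step_gt0 R K)) e.
- exact: cvg_cst.
- rewrite -[X in _ --> X](mulr0 (pi *+ 2)); apply: cvgM; first exact: cvg_cst.
  exact: cvg_harmonic.
Qed.

(** Used with errors of the order of the grid step, which tends to zero. *)
Lemma ucvg_rate (u : nat -> R[i]) l C :
  (forall K, normc (u K - l) <= grid_step R K * C) -> ucvg u l.
Proof.
move=> uC.
have real (g : nat -> R) (y : R) : (forall K, `|g K - y| <= grid_step R K * C) ->
    g @ oultra --> y.
  move=> gC; apply: cvg_trans (_ : g @ \oo --> y).
    by move=> V; exact: oultra_oo.
  have h0 : (fun K => grid_step R K * C) @ \oo --> 0.
    by rewrite -[X in _ --> X](mul0r C); apply: cvgM; [exact: grid_step_cvg0|exact: cvg_cst].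
  apply/subr_cvg0/cvgr0Pnorm_lt => e e0.
  move/cvgr0Pnorm_lt: h0 => /(_ e e0); apply: filterS => K.
  by apply: le_lt_trans; apply: le_trans (gC K) (ler_norm _).
split; apply: real => K; apply: le_trans (uC K).
  by apply: le_trans (Re_le_normc _); case: (u K) => ? ?; case: (l).
by apply: le_trans (Im_le_normc _); case: (u K) => ? ?; case: (l).
Qed.

End QuotientError.

Section Coefficients.
Variables (R : realType) (n : nat).
Implicit Types (phi psi : testfun R n) (l : 'cV[int]_n).

(** The Fourier coefficient of a test function, without integrals: the limit of
    its Riemann sums. *)
Definition coef phi l : R[i] := ulim (fun K => dft K phi l).

Lemma coef_cvg phi l : ucvg (fun K => dft K phi l) (coef phi l).
Proof.
have [B _ sB] := seminorm_exists 0 phi.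
by apply: (@ulim_bounded _ _ (2 * B)) => K; apply: dft_bound => x; exact: normc_le_seminorm sB.
Qed.

(** A derivative differs from the difference quotient by the order of the step, and
    the transform of the quotient is known exactly. The factor
    [(cis (h * l j) - 1) / h] is itself a difference quotient at the origin, that of
    the exponential, so the same estimate gives its limit. *)
Lemma coef_tpd j phi l : coef (tpd j phi) l = ifreq R j l * coef phi l.
Proof.
have [B _ sB] := seminorm_exists 2 phi.
have [B' _ sB'] := seminorm_exists 2 (expik R l).
apply: ucvg_unique (coef_cvg _ _) _.
have -> : (fun K => dft K (tpd j phi) l) = (fun K =>
    ((grid_step R K)^-1)%:C * (cis (grid_step R K * (l j 0)%:~R) - 1) * dft K phi l +
    dft K (fun x => tpd j phi x - dquot (grid_step R K) j phi x) l).
  apply/funext => K; rewrite -dft_dquot; last by move=> i; exact: testfun_periodic.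
  rewrite -[X in X + _]mul1r -dft_lin; congr (dft K _ l); apply/funext => x.
  by rewrite mul1r addrC subrK.
rewrite -[X in ucvg _ X]addr0; apply: ucvgD.
  apply: ucvgM; last exact: coef_cvg.
  apply: (@ucvg_rate _ _ _ (2 * B')) => K.
  have := @dquot_error R n (grid_step R K) j (expik R l) B' 0 (grid_step_gt0 R K) sB'.
  have ex (y : 'cV[R]_n) : expik R l y = cis (phase l y) by [].
  rewrite tpd_expik /dquot !ex add0r phaseZ phase_delta.
  have -> : phase l 0 = 0 :> R by rewrite -(scale0r 0) phaseZ mul0r.
  rewrite cis0 mulr1 => h.
  by rewrite -normcN opprB.
apply: (@ucvg_rate _ _ _ (2 * B)) => K; rewrite subr0; apply: dft_bound => x.
exact: dquot_error (grid_step_gt0 R K) sB.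
Qed.

Lemma testfun_cvg phi (y : nat -> 'cV[R]_n) x : y @ \oo --> x ->
  ucvg (fun K => phi (y K)) (phi x).
Proof.
move=> yx; have [cR _] := testfun_smooth_Re phi [::].
have [cI _] := testfun_smooth_Im phi [::].
have hR : (fun K => complex.Re (phi (y K))) @ \oo --> complex.Re (phi x).
  exact: (continuous_cvg _ (cR x) yx).
have hI : (fun K => complex.Im (phi (y K))) @ \oo --> complex.Im (phi x).
  exact: (continuous_cvg _ (cI x) yx).
by split=> V hV; apply: oultra_oo; [exact: hR|exact: hI].
Qed.

Lemma cell_grid (x : 'cV[R]_n) K : cell x -> exists t : grid n K,
  forall j, `|x j 0 - grid_pt R t j 0| <= grid_step R K.
Proof.
move=> xc; have h0 := grid_step_gt0 R K.
have q0 j : 0 <= x j 0 / grid_step R K.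
  by have /andP[h _] := xc j; rewrite divr_ge0 // ltW.
have lt j : (Num.truncn (x j 0%R / grid_step R K) < grid_size K)%N.
  have /andP[_ h] := xc j; have /andP[h1 _] := truncn_itv (q0 j).
  rewrite -(ltr_nat R); apply: le_lt_trans h1 _.
  by rewrite ltr_pdivrMr // grid_sizeM.
exists [ffun j => Ordinal (lt j)] => j; rewrite mxE ffunE /=.
have /andP[h1 h2] := truncn_itv (q0 j).
move: h1; rewrite ler_pdivlMr // => h1; move: h2; rewrite ltr_pdivrMr // => h2.
rewrite ger0_norm mulrC; last by rewrite subr_ge0.
by rewrite lerBlDr addrC -[X in _ + X]mul1r -mulrDl natr1 ltW.
Qed.

Lemma box_tail K0 l : ~~ in_box K0 l -> K0.+1%:R <= weight R l.
Proof.
rewrite negb_forall => /existsP[j]; rewrite -ltnNge => lj.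
have h : K0.+1%:R <= `|(l j 0)%:~R| :> R by rewrite -intr_norm -[K0.+1%:R]/(K0.+1%:~R) ler_int.
rewrite /weight /enormsq (bigD1 j) //= !mxE -real_normK ?num_real //.
have : 0 <= \sum_(i < n | i != j) (map_mx intr l : 'cV[R]_n) i 0 ^+ 2.
  by apply: sumr_ge0 => i _; exact: sqr_ge0.
have h1 : 1 <= K0.+1%:R :> R by rewrite ler1n.
move: h h1; set a := `|_|; set k := K0.+1%:R; set s := \sum_(_ | _) _ => h h1 s0.
have : a <= a ^+ 2 by rewrite expr2 ler_peMr // (le_trans _ h) // ltW // (lt_le_trans ltr01).
by move=> ?; lra.
Qed.

(** On each grid the finite inversion formula is exact, and the uniform decay
    bounds what is left outside a fixed box; the ultralimit then gives the
    same bound for the function itself. The factor [2] comes from bounding real and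
    imaginary parts separately. *)
Lemma fourier_tail phi K0 B x : seminorm_le n.+1.*2 phi B -> cell x ->
  normc (phi x - \sum_(l <- box n K0) coef phi l * expik R l x) <=
  2 * (decay_cst R n n.+1 * B * 5 ^+ n / K0.+1%:R).
Proof.
move=> sB xc; pose t K : grid n K := sval (cid (cell_grid K xc)).
have ht K : forall j, `|x j 0 - grid_pt R (t K) j 0| <= grid_step R K.
  exact: svalP (cid (cell_grid K xc)).
have yx : (fun K => grid_pt R (t K)) @ \oo --> x.
  apply/cvg_ballP => e e0; have /cvgr0Pnorm_lt /(_ e e0) := @grid_step_cvg0 R.
  apply: filterS => K; rewrite (gtr0_norm (grid_step_gt0 R K)) => Ke.
  split => // i j; rewrite !ord1 /ball /= ; apply: le_lt_trans Ke; exact: ht.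
apply: (@ucvg_norm_le _ (fun K => phi (grid_pt R (t K))
   + -1 * \sum_(l <- box n K0) dft K phi l * expik R l (grid_pt R (t K)))); last first.
  rewrite -[X in _ - X]mul1r -mulNr; apply: ucvgD; first exact: testfun_cvg.
  apply: ucvgM; first exact: ucvg_cst.
  apply: ucvg_sum => l; apply: ucvgM; first exact: coef_cvg.
  exact: testfun_cvg.
apply: filterS (oultra_ge K0) => K KK.
rewrite mulN1r -[X in X - _]dft_inversion.
rewrite -(@big_box n _ K (fun l => dft K phi l * cis (phase l (grid_pt R (t K))))).
rewrite (bigID (in_box K0)) /= big_box_restrict // addrAC subrr add0r.
rewrite big_mkcond /=.
have -> : \sum_(l <- box n K) (if ~~ in_box K0 l
    then dft K phi l * cis (phase l (grid_pt R (t K))) else 0) =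
    \sum_(l <- box n K) cis (phase l (grid_pt R (t K))) *
       (if in_box K0 l then 0 else dft K phi l).
  by apply: eq_bigr => l _; case: (in_box K0 l) => /=; rewrite ?mulr0 // mulrC.
have DB : 0 <= decay_cst R n n.+1 * B.
  have B0 : 0 <= B by have [h _] := sB [::] 0 isT; exact: le_trans h.
  by rewrite mulr_ge0 ?decay_cst_ge0.
rewrite [leRHS](_ : _ = 1 * (decay_cst R n n.+1 * B / K0.+1%:R) * 5 ^+ n); last by ring.
apply: (@box_sum_le _ _ _ 0) => // [l|l lK]; first by rewrite normc_cis expr0 mulr1.
case: ifPn => [_|lK0].
  by rewrite normc0 mulr0 divr_ge0.
rewrite add0n ler_pdivlMr ?ltr0n // mulrC mulrA.
apply: le_trans (dft_decay lK sB); rewrite exprS ler_wpM2r ?normc_ge0 //.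
by rewrite ler_wpM2r ?exprn_ge0 ?(ltW (weight_gt0 _ _)) // box_tail.
Qed.

(** The remainder of a Fourier sum is built as a test function, so that the
    linearity of distributions applies to it term by term. *)
Definition fourier_rem (c : 'cV[int]_n -> R[i]) (r : seq 'cV[int]_n) phi : testfun R n :=
  foldr (fun l psi => tlin (- c l) (expik R l) psi) phi r.

Lemma fourier_remE c r phi x :
  fourier_rem c r phi x = phi x - \sum_(l <- r) c l * expik R l x.
Proof.
elim: r => [|l r IH]; first by rewrite big_nil subr0.
by rewrite big_cons -[LHS]/(- c l * expik R l x + fourier_rem c r phi x) IH opprD
  addrCA mulNr.
Qed.

Lemma tpd_fourier_rem j c r phi x :
  tpd j (fourier_rem c r phi) x = fourier_rem (fun l => ifreq R j l * c l) r (tpd j phi) x.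
Proof.
elim: r => [//|l r IH].
rewrite -[fourier_rem c _ _]/(tlin (- c l) (expik R l) (fourier_rem c r phi)).
rewrite tpd_lin tpd_expik IH.
rewrite -[RHS]/(- (ifreq R j l * c l) * expik R l x + fourier_rem _ r _ x).
by congr (_ + _); ring.
Qed.

(** Derivatives commute with Fourier sums, hence the sup-norm bound of
    [fourier_tail] is a bound in every seminorm. *)
Lemma tpds_fourier_rem w r phi x :
  tpds w (fourier_rem (coef phi) r phi) x = fourier_rem (coef (tpds w phi)) r (tpds w phi) x.
Proof.
elim: w x => [//|j w IH] x; rewrite -[tpds (j :: w) _]/(tpd j (tpds w _)).
rewrite (eq_tpd j IH) tpd_fourier_rem !fourier_remE; congr (_ - _).
by apply: eq_bigr => l _; rewrite -[tpds (j :: w) _]/(tpd j (tpds w phi)) coef_tpd.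
Qed.

Lemma fourier_rem_seminorm N K phi B : seminorm_le (n.+1.*2 + N) phi B ->
  seminorm_le N (fourier_rem (coef phi) (box n K) phi)
    (2 * (decay_cst R n n.+1 * B * 5 ^+ n / K.+1%:R)).
Proof.
move=> sB w x wN; set r := fourier_rem _ _ _.
have sw : seminorm_le n.+1.*2 (tpds w phi) B.
  apply: seminorm_tpds => v y vN; apply: sB; apply: leq_trans vN _.
  by rewrite leq_add2l.
have hb : normc (tpds w r x) <= 2 * (decay_cst R n n.+1 * B * 5 ^+ n / K.+1%:R).
  have [y yc ->] := cell_reduce x (@testfun_periodic _ _ (tpds w r)).
  by rewrite tpds_fourier_rem fourier_remE; exact: fourier_tail.
by rewrite -Re_tpds -Im_tpds; split; apply: le_trans hb;
  [exact: Re_le_normc|exact: Im_le_normc].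
Qed.

Lemma pvdist_fourier_rem (u : pvdist R n) c r phi :
  u (fourier_rem c r phi) = u phi - \sum_(l <- r) c l *: u (expik R l).
Proof.
elim: r => [|l r IH]; first by rewrite big_nil subr0.
rewrite (@pvdist_linear _ _ u (- c l) (expik R l) (fourier_rem c r phi)) //.
by rewrite IH big_cons opprD addrCA scaleNr.
Qed.

Lemma le_div_nat (y Q : R) : 0 <= Q -> (forall K, y <= Q / K.+1%:R) -> y <= 0.
Proof.
move=> Q0 h; have e : (fun K => Q * harmonic K) @ \oo --> (0 : R).
  by rewrite -[X in _ --> X](mulr0 Q); apply: cvgM; [exact: cvg_cst|exact: cvg_harmonic].
apply: (ler_cvg_to (cvg_cst y) e).
by apply: filterE => K; exact: h.
Qed.

(** By linearity two distributions with the same coefficients take the same value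
    on a Fourier sum, so their difference is the same on a test function and
    on its remainders, which tend to zero in all seminorms. *)
Lemma pvdist_eq (u1 u2 : pvdist R n) : (forall k, fcoef u1 k = fcoef u2 k) -> u1 = u2.
Proof.
move=> e.
have vol0 : (((pi *+ 2) ^+ n)^-1)%:C != 0 :> R[i].
  rewrite (inj_eq (@complexI R) _ 0) invr_eq0 expf_neq0 //.
  by rewrite mulrn_eq0 /= gt_eqF ?pi_gt0.
have ek l : u1 (expik R l) = u2 (expik R l).
  have := e (- l); rewrite /fcoef opprK => /eqP; rewrite -subr_eq0 -scalerBr.
  by rewrite scaler_eq0 (negbTE vol0) /= subr_eq0 => /eqP.
have key phi : u1 phi = u2 phi.
  have [N1 [C1 h1]] := pvdist_continuous u1.
  have [N2 [C2 h2]] := pvdist_continuous u2.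
  pose N := maxn N1 N2; have [B B0 sB] := seminorm_exists (n.+1.*2 + N) phi.
  pose Q := 2 * (decay_cst R n n.+1 * B * 5 ^+ n).
  have Q0 : 0 <= Q by rewrite mulr_ge0 // mulr_ge0 ?exprn_ge0 // mulr_ge0 ?decay_cst_ge0.
  apply/colP => j; apply/eqP; rewrite -subr_eq0; apply/eqP/eq0_normc.
  apply/eqP; rewrite eq_le normc_ge0 andbT.
  apply: (@le_div_nat _ ((`|C1| + `|C2|) * Q)); first by rewrite mulr_ge0 ?addr_ge0.
  move=> K; pose r := fourier_rem (coef phi) (box n K) phi.
  have -> : u1 phi j 0 - u2 phi j 0 = u1 r j 0 - u2 r j 0.
    rewrite !pvdist_fourier_rem !mxE.
    under eq_bigr do rewrite ek.
    ring.
  have sr : seminorm_le N r (Q / K.+1%:R).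
    by rewrite /Q -mulrA; exact: fourier_rem_seminorm.
  have QK : 0 <= Q / K.+1%:R by rewrite divr_ge0.
  rewrite -mulrA mulrDl; apply: le_trans (le_normcD _ _) _; rewrite normcN.
  apply: lerD.
    apply: le_trans (h1 r (Q / K.+1%:R) _ j) _; last by rewrite ler_wpM2r // ler_norm.
    by move=> w x wN; apply: sr; rewrite leq_max wN.
  apply: le_trans (h2 r (Q / K.+1%:R) _ j) _; last by rewrite ler_wpM2r // ler_norm.
  by move=> w x wN; apply: sr; rewrite leq_max wN orbT.
move: u1 u2 {e ek} key => [f1 l1 c1] [f2 l2 c2] /= key.
have f12 : f1 = f2 by exact/funext.
(* the remaining fields are propositions *)
by subst f2; congr PVDist; exact: Prop_irrelevance.
Qed.

End Coefficients.

(** * Inverse multipliers and Sobolev norms *)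

Section SpectralMatrix.
Variables (R : realType) (n : nat).
Implicit Types (nu : 'cV[R]_n) (p q : R).

(** The matrix with eigenvalue [q] along [nu] and [p] on its orthogonal: the
    multipliers and their inverses both have this shape. *)
Definition spectral_mx p q nu : 'M[R]_n :=
  p%:M + ((q - p) / enormsq nu) *: (nu *m nu^T).

Lemma spectral_mxM p q p' q' nu : nu != 0 ->
  spectral_mx p q nu *m spectral_mx p' q' nu = spectral_mx (p * p') (q * q') nu.
Proof.
rewrite -enormsq_eq0 => e0; rewrite /spectral_mx; set e := enormsq nu; set A := nu *m nu^T.
have AA : A *m A = e *: A.
  by rewrite /A mulmxA -[nu *m _ *m nu]mulmxA enormsqE mul_mx_scalar -scalemxAl.
rewrite mulmxDl !mulmxDr -!scalemxAl -!scalemxAr AA mul_scalar_mx.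
rewrite mul_mx_scalar scale_scalar_mx mul_scalar_mx !scalerA -!addrA -!scalerDl.
by congr (_ + _ *: _); field.
Qed.

Lemma spectral_mx1 nu : spectral_mx 1 1 nu = 1%:M.
Proof. by rewrite /spectral_mx subrr mul0r scale0r addr0. Qed.

Lemma spectral_mx_entry_le p q nu r i l : nu != 0 -> `|p| <= r -> `|q| <= r ->
  `|spectral_mx p q nu i l| <= 3 * r.
Proof.
rewrite -enormsq_eq0 => e0 pr qr.
have e1 : 0 < enormsq nu by rewrite lt_def e0 enormsq_ge0.
have sq j : nu j 0 ^+ 2 <= enormsq nu.
  by rewrite /enormsq (bigD1 j) //= lerDl; apply: sumr_ge0 => k _; exact: sqr_ge0.
have r0 : 0 <= r := le_trans (normr_ge0 _) pr.
have h : `|nu i 0 * nu l 0| <= enormsq nu.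
  have := sq i; have := sq l; have := sqr_ge0 (nu i 0 - nu l 0).
  have := sqr_ge0 (nu i 0 + nu l 0).
  by move: (nu i 0) (nu l 0) (enormsq nu) => x y z ? ? ? ?; rewrite ler_norml; lra.
rewrite /spectral_mx !mxE big_ord1 !mxE.
have -> : 3 * r = r + (r + r) by ring.
apply: le_trans (ler_normD _ _) _; apply: lerD.
  by case: (i == l); rewrite ?mulr1n ?mulr0n ?normr0.
rewrite -mulrA normrM; apply: (@le_trans _ _ ((r + r) * 1)); last by rewrite mulr1.
apply: ler_pM => //.
  by apply: le_trans (ler_normB _ _) _; apply: lerD.
rewrite normrM [`|_^-1|]gtr0_norm ?invr_gt0 // mulrC.
by rewrite ler_pdivrMr // mul1r.
Qed.

Lemma cnormsq_ge0 (z : 'cV[R[i]]_n) : 0 <= cnormsq z.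
Proof. by apply: sumr_ge0 => i _; exact: sqr_ge0. Qed.

Lemma normc_sqr_le (z : 'cV[R[i]]_n) j : normc (z j 0) ^+ 2 <= cnormsq z.
Proof.
by rewrite /cnormsq (bigD1 j) //= lerDl; apply: sumr_ge0 => k _; exact: sqr_ge0.
Qed.

(** A crude bound is enough: only the dependence on [r] matters. *)
Lemma cnormsq_mulmx_le (M : 'M[R]_n) r (z : 'cV[R[i]]_n) : 0 <= r ->
  (forall i l, `|M i l| <= r) ->
  cnormsq (map_mx (real_complex R) M *m z) <= n%:R ^+ 3 * r ^+ 2 * cnormsq z.
Proof.
move=> r0 Mr; set S := cnormsq z; have S0 : 0 <= S := cnormsq_ge0 z.
have zl l : normc (z l 0) <= Num.sqrt S.
  rewrite -[normc _]ger0_norm ?normc_ge0 // -sqrtr_sqr ler_sqrt //.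
  exact: normc_sqr_le.
have ent i : normc ((map_mx (real_complex R) M *m z) i 0) <= n%:R * (r * Num.sqrt S).
  rewrite mxE; apply: le_trans (le_normc_sum _ _ _) _.
  apply: (@le_trans _ _ (\sum_(l < n) r * Num.sqrt S)).
    apply: ler_sum => l _; rewrite mxE normcM normc_real.
    by apply: ler_pM => //; exact: normc_ge0.
  by rewrite sumr_const card_ord mulr_natl.
apply: (@le_trans _ _ (\sum_(i < n) (n%:R * (r * Num.sqrt S)) ^+ 2)).
  apply: ler_sum => i _; rewrite lerXn2r ?nnegrE ?normc_ge0 //.
  by rewrite mulr_ge0 // mulr_ge0 // sqrtr_ge0.
rewrite sumr_const card_ord -mulr_natl !exprMn sqr_sqrtr //.
by rewrite le_eqVlt; apply/orP; left; apply/eqP; ring.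
Qed.

End SpectralMatrix.

Section Sobolev.
Variables (R : realType) (n : nat).

Lemma esum_scale_lty (T : choiceType) (a : T -> \bar R) (C : R) : 0 <= C ->
  (forall i, (0 <= a i)%E) -> (\esum_(i in [set: T]) a i < +oo)%E ->
  (\esum_(i in [set: T]) (C%:E * a i) < +oo)%E.
Proof.
move=> C0 a0 afin.
apply: (@le_lt_trans _ _ (C%:E * \esum_(i in [set: T]) a i)%E).
  apply: ge_ereal_sup => _ [X finX <-].
  rewrite -ge0_mule_fsumr //; apply: lee_wpmul2l; first by rewrite lee_fin.
  by apply: esum_ge; exists X.
by rewrite lte_mul_pinfty // ?lee_fin // ge0_fin_numE // esum_ge0.
Qed.

Definition sobolev_term (q : R) (z : 'cV[int]_n -> 'cV[R[i]]_n) k : R :=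
  weight R k `^ q * cnormsq (z k).

Lemma sobolev_term_ge0 q z k : 0 <= sobolev_term q z k.
Proof. by rewrite mulr_ge0 ?powR_ge0 ?cnormsq_ge0. Qed.

Lemma in_sobolev_term q (b : pvdist R n) : in_sobolev q b ->
  exists2 T, 0 <= T & forall k, sobolev_term q (fcoef b) k <= T.
Proof.
move=> hb; pose E := (\esum_(k in [set: 'cV[int]_n]) (sobolev_term q (fcoef b) k)%:E)%E.
have hE : (E < +oo)%E := hb.
have E0 : (0 <= E)%E by apply: esum_ge0 => k _; rewrite lee_fin sobolev_term_ge0.
have Efin : E \is a fin_num by rewrite ge0_fin_numE.
exists (fine E); first exact: fine_ge0.
move=> k; rewrite -lee_fin fineK //; apply: esum_ge; exists [set k] => //.
by rewrite fsbig_set1.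
Qed.

Lemma in_sobolev_le q q' (u b : pvdist R n) C : 0 <= C ->
  (forall k, sobolev_term q' (fcoef u) k <= C * sobolev_term q (fcoef b) k) ->
  in_sobolev q b -> in_sobolev q' u.
Proof.
move=> C0 h hb.
have := @esum_scale_lty _ (fun k => (sobolev_term q (fcoef b) k)%:E) C C0
  (fun k => sobolev_term_ge0 _ _ _) hb.
apply: le_lt_trans; apply: le_esum => k _; rewrite -EFinM lee_fin; exact: h.
Qed.

(** The negative power [- q] of the weight is at most a natural power, so
    Sobolev coefficients are admissible in [pvdist_of_coef]. *)
Lemma poly_growth q T (z : 'cV[int]_n -> 'cV[R[i]]_n) : 0 <= T ->
  (forall k, sobolev_term q z k <= T) ->
  exists A, exists2 P, 0 <= A & forall k j, normc (z k j 0) <= A * weight R k ^+ P.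
Proof.
move=> T0 zT; pose P := (Num.truncn `|q|).+1.
(* a bound on a square also bounds the number itself once it is at least [1] *)
exists (T + 1), P; first by rewrite addr_ge0.
move=> k j; have w1 := weight_ge1 R k; have w0 := weight_gt0 R k.
have qP : - q <= P%:R.
  apply: le_trans (ler_norm _) _; rewrite normrN.
  by have /andP[_ /ltW] := truncn_itv (normr_ge0 q).
have h : cnormsq (z k) <= T * weight R k ^+ P.
  apply: (@le_trans _ _ (weight R k `^ (- q) * T)).
    rewrite powRN mulrC ler_pdivlMr ?powR_gt0 // mulrC; exact: zT.
  rewrite mulrC ler_wpM2l // -powR_mulrn ?(ltW w0) //.
  by rewrite ler_powR.
have wP : 1 <= weight R k ^+ P by exact: exprn_ege1.
have {}h := le_trans (normc_sqr_le (z k) j) h.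
have := normc_ge0 (z k j 0); move: h; move: (normc _) (weight R k ^+ P) wP => y W W1 h y0.
have [y1|y1] := leP y 1.
  by apply: le_trans y1 _; rewrite mulrDl mul1r (le_trans W1) // lerDr mulr_ge0 //
    (le_trans ler01).
apply: (@le_trans _ _ (y ^+ 2)); first by rewrite expr2 ler_peMr // ltW.
by apply: le_trans h _; rewrite mulrDl mul1r lerDl (le_trans ler01).
Qed.

End Sobolev.

Section FrequencyNorm.
Variables (R : realType) (n : nat).

Lemma freq_neq0 (k : 'cV[int]_n) : k != 0 -> (map_mx intr k : 'cV[R]_n) != 0.
Proof.
apply: contra => /eqP /colP h; apply/eqP/colP => j.
by have := h j; rewrite !mxE => /eqP; rewrite intr_eq0 => /eqP.
Qed.

Lemma freq_enormsq_ge1 (k : 'cV[int]_n) : k != 0 ->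
  1 <= enormsq (map_mx intr k : 'cV[R]_n).
Proof.
move=> k0; have [j kj] : exists j, k j 0 != 0.
  apply/existsP; rewrite -negb_forall; apply: contra k0 => /forallP h.
  by apply/eqP/colP => j; rewrite mxE; apply/eqP.
rewrite /enormsq (bigD1 j) //= -[leLHS]addr0; apply: lerD; last first.
  by apply: sumr_ge0 => i _; exact: sqr_ge0.
rewrite !mxE -real_normK ?num_real // exprn_ege1 // -intr_norm.
by rewrite -[1]/(1%:~R) ler_int -gtz0_ge1 normr_gt0.
Qed.

End FrequencyNorm.

(** * Well-posedness *)

Theorem theorem13 (R : realType) (n : nat) (delta beta mu lams : R)
    (hn : (1 <= n)%N) (hdelta : 0 < delta) (hbeta : beta < n%:R + 2)
    (hmu : 0 < mu)
    (hlambda1 : forall nu : 'cV[R]_n, nu != 0 ->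
       lambda1 delta beta mu lams nu < 0)
    (hlambda2 : forall nu : 'cV[R]_n, nu != 0 ->
       lambda2 delta beta mu nu < 0)
    (s : R) (b : pvdist R n) (hb : in_sobolev s b) (hb0 : fcoef b 0 = 0) :
  exists! u : pvdist R n,
    [/\ in_sobolev (s + Num.max 0 (beta - n%:R)) u,
        is_peridynamic delta beta mu lams u b
      & fcoef u 0 = 0].
Proof.
pose fr (k : 'cV[int]_n) : 'cV[R]_n := map_mx intr k.
pose l1 k := lambda1 delta beta mu lams (fr k).
pose l2 k := lambda2 delta beta mu (fr k).
pose Minv k := map_mx (real_complex R) (spectral_mx (l2 k)^-1 (l1 k)^-1 (fr k)).
have Mk k : multiplier delta beta mu lams (fr k) = spectral_mx (l2 k) (l1 k) (fr k) by [].
(* at frequency [0] the multiplier vanishes and the mean value is prescribed *)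
pose v k := if k == 0 then 0 else Minv k *m fcoef b k.
have l1n k : k != 0 -> l1 k != 0 by move=> /freq_neq0 /hlambda1 /lt_eqF ->.
have l2n k : k != 0 -> l2 k != 0 by move=> /freq_neq0 /hlambda2 /lt_eqF ->.
have MV k : k != 0 -> map_mx (real_complex R) (multiplier delta beta mu lams (fr k))
    *m Minv k = 1%:M.
  move=> k0; rewrite -map_mxM Mk spectral_mxM ?freq_neq0 // !mulfV ?l1n ?l2n //.
  by rewrite spectral_mx1 map_mx1.
have VM k : k != 0 -> Minv k *m
    map_mx (real_complex R) (multiplier delta beta mu lams (fr k)) = 1%:M.
  move=> k0; rewrite -map_mxM Mk spectral_mxM ?freq_neq0 // !mulVf ?l1n ?l2n //.
  by rewrite spectral_mx1 map_mx1.
have [kap kap0 lower] := lambda_lower hn hdelta hbeta hmu hlambda1 hlambda2.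
set th : R := Num.max 0 _ in lower.
have th0 : 0 <= th by rewrite le_max lexx.
have thE : Num.max 0 (beta - n%:R) = 2 * th.
  by rewrite /th maxr_pMr // mulr0; congr (Num.max _ _); field.
pose C : R := n%:R ^+ 3 * (3 * kap^-1) ^+ 2.
have C0 : 0 <= C := mulr_ge0 (exprn_ge0 _ (ler0n _ _)) (sqr_ge0 _).
have vle k : sobolev_term (s + 2 * th) v k <= C * sobolev_term s (fcoef b) k.
  rewrite /sobolev_term /v; case: eqVneq => [->|k0].
    have -> : cnormsq (0 : 'cV[R[i]]_n) = 0.
      by rewrite /cnormsq big1 // => i _; rewrite mxE normc0 expr0n.
    rewrite mulr0; apply: mulr_ge0 => //.
    exact: mulr_ge0 (powR_ge0 _ _) (cnormsq_ge0 _).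
  have w0 := weight_gt0 R k; have wt : 0 < weight R k `^ th by rewrite powR_gt0.
  have [h1 h2] := lower (fr k) (freq_enormsq_ge1 R k0).
  pose r := (kap * weight R k `^ th)^-1.
  have kw : 0 < kap * weight R k `^ th by rewrite mulr_gt0.
  have r0 : 0 <= r by rewrite invr_ge0 ltW.
  have inv_le (y : R) : kap * weight R k `^ th <= - y -> `|y^-1| <= r.
    move=> hy; have y0 : 0 < - y by exact: lt_le_trans hy.
    by rewrite normfV -normrN gtr0_norm // lef_pV2.
  have := @cnormsq_mulmx_le R n (spectral_mx (l2 k)^-1 (l1 k)^-1 (fr k)) (3 * r)
    (fcoef b k) (mulr_ge0 (ler0n _ 3) r0) (fun i l => spectral_mx_entry_le i l
      (freq_neq0 R k0) (inv_le _ h2) (inv_le _ h1)).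
  rewrite -/(Minv k) => H; apply: (le_trans (ler_wpM2l (powR_ge0 _ _) H)).
  rewrite powRD; last by rewrite (gt_eqF w0) implybT.
  rewrite mulr_natl mulr2n powRD; last by rewrite (gt_eqF w0) implybT.
  rewrite /C /r; set W := weight R k `^ th; set Z := weight R k `^ s.
  rewrite le_eqVlt; apply/orP; left; apply/eqP; field.
  by rewrite !gt_eqF.
(* the index [s + 2 * th] is at least [s], so the index of [b] controls [v] too *)
have vle0 k : sobolev_term s v k <= C * sobolev_term s (fcoef b) k.
  apply: le_trans (vle k); rewrite /sobolev_term ler_wpM2r ?cnormsq_ge0 //.
  by rewrite ler_powR ?weight_ge1 // lerDl mulr_ge0.
have [T T0 hT] := in_sobolev_term hb.
have [A [P A0 hA]] : exists A, exists2 P, 0 <= A &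
    forall k j, normc (v k j 0) <= A * weight R k ^+ P.
  apply: (@poly_growth R n s (C * T)) => [|k]; first exact: mulr_ge0.
  by apply: le_trans (vle0 k) _; rewrite ler_wpM2l.
have [u uv] := pvdist_of_coef A0 hA.
exists u; split; first split.
- rewrite thE; apply: in_sobolev_le hb; first exact: C0.
  by move=> k; rewrite /sobolev_term uv; exact: vle.
- move=> k; rewrite uv /v; case: eqVneq => [->|k0]; first by rewrite hb0 mulmx0.
  by rewrite mulmxA MV // mul1mx.
- by rewrite uv /v eqxx.
move=> u' [_ hu' u'0]; apply: pvdist_eq => k; rewrite uv /v.
case: eqVneq => [->|k0]; first by rewrite u'0.
by rewrite hu' mulmxA VM // mul1mx.
Qed.
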